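(* Let $\mathcal H$ be a complex separable Hilbert space, $\Sigma$ a Hausdorff, locally compact, $\sigma$-compact space endowed with a fixed Radon measure $\mu$, and $\pi:\Sigma\to\mathbb B(\mathcal H)$ a map such that: (a) $\int_\Sigma |\langle\pi(s)u,v\rangle|^2\,d\mu(s)=\|u\|^2\|v\|^2$ for all $u,v\in\mathcal H$; (b) $s\mapsto\pi(s)^*$ is strongly continuous; (c) the isometry $\Phi^\pi:\mathcal H\widehat\otimes\overline{\mathcal H}\to L^2(\Sigma)$ determined by $[\Phi^\pi(u\otimes v)](s)=\langle \pi(s)u,v\rangle$ is surjective; (d) $\pi(s_1)^*=1$ for some $s_1\in\Sigma$. A bounded subset $\Omega$ of $\mathcal H$ is relatively compact if and only if any one of the following equivalent conditions holds: (1) For some $w\in\mathcal H\setminus\{0\}$ (equivalently, for every $w\in\mathcal H$) the family $\phi^\pi_w(\Omega)$ is $C_{\rm c}(\Sigma)$-tight in $L^2(\Sigma)$, where $L^2(\Sigma)$ is regarded as a Banach left module over $C_0(\Sigma)$ by pointwise multiplication. (2) The set $\Omega$ is $\Pi[C_{\rm c}(\Sigma)]$-tight, with respect to the Banach left module structure $\mathbb B(\mathcal H)\times\mathcal H\to\mathcal H$. (3) $\lim_{s\to s_0}\sup_{u\in\Omega}\|\pi(s)^*u-\pi(s_0)^*u\|=0$ for every $s_0\in\Sigma$.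
   Context: Inner products are linear in the first variable. $\mathbb B(\mathcal H)$ is the algebra of bounded operators on $\mathcal H$, $\overline{\mathcal H}$ is the conjugate Hilbert space of $\mathcal H$, $\widehat\otimes$ is the Hilbert space tensor product, $L^2(\Sigma)=L^2(\Sigma;\mu)$, $C_{\rm c}(\Sigma)$ is the space of continuous compactly supported complex functions on $\Sigma$ and $C_0(\Sigma)$ the $C^*$-algebra of continuous complex functions on $\Sigma$ vanishing at infinity. For $w\in\mathcal H$, $\phi^\pi_w:\mathcal H\to L^2(\Sigma)$ is defined by $[\phi^\pi_w(u)](s):=\langle\pi(s)u,w\rangle$. Symbolic calculus: $\Pi:=\Lambda\circ(\Phi^\pi)^{-1}:L^2(\Sigma)\to\mathbb B_2(\mathcal H)$ (Hilbert-Schmidt operators), where $\Lambda:\mathcal H\widehat\otimes\overline{\mathcal H}\to\mathbb B_2(\mathcal H)$ is the unitary map determined by $\Lambda(u\otimes v)=\langle\cdot,v\rangle u$. Equivalently, in the weak sense, $\Pi(f)=\int_\Sigma f(s)\pi(s)^*\,d\mu(s)$. Tightness: if a Banach space $\mathcal Y$ is a Banach left module over a normed algebra $\mathcal A$ (a left module with $\|a\cdot y\|_{\mathcal Y}\le\|a\|_{\mathcal A}\|y\|_{\mathcal Y}$) and $\mathcal A^0\subset\mathcal A$, a bounded set $\Gamma\subset\mathcal Y$ is called $\mathcal A^0$-tight if for every $\epsilon>0$ there exists $a\in\mathcal A^0$ with $\sup_{y\in\Gamma}\|a\cdot y-y\|_{\mathcal Y}\le\epsilon$.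
   Formalization: The point s_1 in (d) is additionally assumed to lie in the support of μ (every open neighbourhood of s_1 has positive measure); without this, condition (3) need not imply relative compactness, and the case H = 0 breaks condition (1). *)

(* Defs.v *)
From HB Require Import structures.
From mathcomp Require Import all_boot all_order all_algebra.
From mathcomp Require Import all_classical all_reals all_analysis.
From mathcomp Require Import complex.

Set Implicit Arguments.
Unset Strict Implicit.
Unset Printing Implicit Defensive.

Import Order.TTheory GRing.Theory Num.Def Num.Theory.
Import numFieldNormedType.Exports.

Local Open Scope classical_set_scope.
Local Open Scope ring_scope.

(* Norms over R[i] take their values in R[i]; [rnorm] reads them in R. *)
Definition rnorm (R : realType) (V : normedZmodType R[i]) (x : V) : R :=
  complex.Re `|x|.

HB.mixin Record isHilbert (R : realType) H
    & CompleteNormedModule R[i] H := {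
  hdot : {dot H for (@conjC R[i])} ;
  hdot_norm : forall u : H, hdot u u = `|u| ^+ 2
}.

#[short(type="hilbertType")]
HB.structure Definition Hilbert (R : realType) :=
  {H of CompleteNormedModule R[i] H & isHilbert R H}.

Section conjugate_space.
Variables (R : realType) (H : hilbertType R).

Definition conj_hilbert : Type := H.

HB.instance Definition _ := PseudoMetricNormedZmod.copy conj_hilbert H.
HB.instance Definition _ := Complete.copy conj_hilbert H.

Definition conj_scale (a : R[i]) (v : conj_hilbert) : conj_hilbert :=
  a^* *: (v : H).

Fact conj_scaleA a b v : conj_scale a (conj_scale b v) = conj_scale (a * b) v.
Proof. by rewrite /conj_scale scalerA -rmorphM. Qed.
Fact conj_scale1 : left_id 1 conj_scale.
Proof. by move=> v; rewrite /conj_scale rmorph1 scale1r. Qed.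
Fact conj_scaleDr : right_distributive conj_scale +%R.
Proof. by move=> a u v; rewrite /conj_scale scalerDr. Qed.
Fact conj_scaleDl v : {morph conj_scale^~ v : a b / a + b}.
Proof. by move=> a b; rewrite /conj_scale rmorphD scalerDl. Qed.

HB.instance Definition _ := GRing.Zmodule_isLmodule.Build R[i] conj_hilbert
  conj_scaleA conj_scale1 conj_scaleDr conj_scaleDl.

Fact conj_normrZ (a : R[i]) (v : conj_hilbert) : `|a *: v| = `|a| * `|v|.
Proof. by rewrite -(norm_conjC a); exact: (@normrZ _ H). Qed.

HB.instance Definition _ :=
  PseudoMetricNormedZmod_Lmodule_isNormedModule.Build R[i] conj_hilbert
    conj_normrZ.

Definition conj_hdot (u v : conj_hilbert) : R[i] := hdot (v : H) (u : H).

Fact conj_hdot_bilinear : bilinear_for *%R (conjC \; *%R) conj_hdot.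
Proof.
split=> [v|u] a x y; rewrite /conj_hdot.
  by rewrite linearDr linearZr/= conjCK.
by rewrite linearDl linearZl.
Qed.

HB.instance Definition _ := bilinear_isBilinear.Build R[i] conj_hilbert
  conj_hilbert R[i] *%R (conjC \; *%R) conj_hdot conj_hdot_bilinear.

Fact conj_hdot_hermitian (u v : conj_hilbert) :
  conj_hdot u v = (-1) ^+ false * (conj_hdot v u)^*.
Proof. by rewrite /conj_hdot hermC. Qed.

HB.instance Definition _ := isHermitianSesquilinear.Build R[i] conj_hilbert
  false conjC conj_hdot conj_hdot_hermitian.

Fact conj_hdot_gt0 (u : conj_hilbert) : u != 0 -> 0 < conj_hdot u u.
Proof. exact: (@neq0_dnorm_gt0 _ _ _ (@hdot R H)). Qed.

HB.instance Definition _ := isDotProduct.Build R[i] conj_hilbert conj_hdot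
  conj_hdot_gt0.

HB.instance Definition _ := @isHilbert.Build R conj_hilbert
  (conj_hdot : {dot conj_hilbert for (@conjC R[i])}) (fun u => @hdot_norm R H u).

End conjugate_space.

Definition separable (T : topologicalType) : Prop :=
  exists2 D : set T, countable D & dense D.

Section operators.
Variables (R : realType) (H : hilbertType R).

Record bounded_op := BoundedOp {
  bounded_op_linear :> {linear H -> H};
  bounded_opP : bounded_near bounded_op_linear (nbhs 0)
}.

(* The vector w with <T u, v> = <u, w> for all u is unique, and it exists by
   the Riesz representation theorem. *)
Definition adjoint (T : bounded_op) (v : H) : H :=
  xget 0 [set w | forall u, hdot (T u) v = hdot u w].

(* The square of the Hilbert-Schmidt norm: the sum over a Hilbert basis is the
   supremum of the sums over the finite orthonormal families. *)
Definition hs_norm2 (T : bounded_op) : \bar R :=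
  ereal_sup [set (\sum_(e <- s) rnorm (T e) ^+ 2)%:E
            | s in [set s : seq H | orthonormal hdot s]].

Definition hilbert_schmidt (T : bounded_op) : Prop := (hs_norm2 T < +oo)%E.

Definition hs_unitary (K : hilbertType R) (L : K -> bounded_op) : Prop :=
  [/\ forall a k l x, L (a *: k + l) x = a *: L k x + L l x,
      forall k, hs_norm2 (L k) = (rnorm k ^+ 2)%:E &
      forall T, hilbert_schmidt T -> exists k, L k =1 T].

End operators.

(* A model of the Hilbert space tensor product of H1 and H2; it is unique up to
   a unitary map compatible with the simple tensors. *)
Definition hilbert_tensor (R : realType) (H1 H2 K : hilbertType R)
    (tens : {bilinear H1 -> H2 -> K}) : Prop :=
  (forall u u' v v',
     hdot (tens u v) (tens u' v') = hdot u u' * hdot v v') /\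
  dense [set k | exists n (u : 'I_n -> H1) (v : 'I_n -> H2),
                   k = \sum_(i < n) tens (u i) (v i)].

Definition sigma_compact (T : topologicalType) : Prop :=
  exists2 F : nat -> set T,
    forall n, compact (F n) & \bigcup_n F n = [set: T].

Notation borel T := (g_sigma_algebraType (@open T)).

Definition radon (R : realType) (T : ptopologicalType)
    (mu : {measure set (borel T) -> \bar R}) : Prop :=
  [/\ forall C : set T, compact C -> (mu C < +oo)%E,
      forall A : set (borel T), measurable A ->
        mu A = ereal_inf [set mu U | U in [set U : set T | open U /\ A `<=` U]] &
      forall U : set T, open U ->
        mu U = ereal_sup [set mu C | C in [set C : set T | compact C /\ C `<=` U]]].

Definition measure_support (R : realType) (T : ptopologicalType)
    (mu : {measure set (borel T) -> \bar R}) : set T :=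
  [set s | forall U : set T, open U -> U s -> (0 < mu U)%E].

(* L^2(T; mu) is handled through its representatives: square-integrable
   functions, compared up to equality almost everywhere. *)
Section square_integrable.
Variables (R : realType) (T : ptopologicalType).
Variable mu : {measure set (borel T) -> \bar R}.

Definition l2norm (f : T -> R[i]) : \bar R :=
  Lnorm mu 2%:E (fun s => (rnorm (f s))%:E).

Definition square_integrable (f : T -> R[i]) : Prop :=
  [/\ measurable_fun [set: borel T] (fun s : borel T => complex.Re (f s)),
      measurable_fun [set: borel T] (fun s : borel T => complex.Im (f s)) &
      (l2norm f < +oo)%E].

Definition l2_isometry (K : hilbertType R) (Phi : K -> T -> R[i]) : Prop :=
  [/\ forall k, square_integrable (Phi k),
      forall a k l, \forall s \ae mu, Phi (a *: k + l) s = a * Phi k s + Phi l s &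
      forall k, l2norm (Phi k) = (rnorm k)%:E].

Definition l2_surjective (K : hilbertType R) (Phi : K -> T -> R[i]) : Prop :=
  forall f, square_integrable f -> exists k, Phi k = f %[ae mu].

(* The operator Lam (Phi^-1 f), for Phi injective and onto up to equality
   almost everywhere. *)
Definition symbolic_calculus (H K : hilbertType R)
    (Phi : K -> T -> R[i]) (Lam : K -> bounded_op H) (f : T -> R[i]) :
    bounded_op H :=
  Lam (xget 0 [set k | Phi k = f %[ae mu]]).

End square_integrable.

Definition Cc (R : realType) (T : topologicalType) : set (T -> R[i]) :=
  [set f | continuous (f : T -> R[i]^o) /\
           compact (closure [set s | f s != 0])].

(* [act] is the action of the algebra carried by A on the module Y, [nrm] the
   norm of Y and A0 the distinguished subset of A. *)
Definition tight (R : realType) (A : Type) (Y : zmodType) (act : A -> Y -> Y)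
    (nrm : Y -> \bar R) (A0 : set A) (G : set Y) : Prop :=
  forall eps : R, 0 < eps -> exists2 a, A0 a &
    (ereal_sup [set nrm (act a y - y)%R | y in G] <= eps%:E)%E.

Definition tight_L2 (R : realType) (T : ptopologicalType)
    (mu : {measure set (borel T) -> \bar R}) :
    set (T -> R[i]) -> set (T -> R[i]) -> Prop :=
  tight (fun (a f : T -> R[i]) s => a s * f s) (l2norm mu).

Definition tight_hilbert (R : realType) (H : hilbertType R) :
    set (bounded_op H) -> set H -> Prop :=
  tight (fun (S : bounded_op H) (u : H) => S u) (fun u => (rnorm u)%:E).

Definition phi (R : realType) (H : hilbertType R) (T : Type)
    (pi : T -> bounded_op H) (w u : H) : T -> R[i] :=
  fun s => hdot (pi s u) w.

(* The supremum in [0, +oo]: it is 0 for the empty family. *)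
Definition nneg_sup (R : realType) (A : set (\bar R)) : \bar R :=
  ereal_sup (0%E |` A).

(* Main.v *)
Require Import Defs.
From HB Require Import structures.
From mathcomp Require Import all_boot all_order all_algebra.
From mathcomp Require Import all_classical all_reals all_analysis.
From mathcomp Require Import measurable_realfun complex ring lra.

(** Put [g s w = adjoint (pi s) w], so that [phi pi w u s = <u, g s w>]. By the
square-integrability of [pi], [u |-> phi pi w u] is [rnorm w] times an isometry
into L^2.

The implications towards compactness rest on one criterion,
[relatively_compact_of_weak_control]: a bounded set [Omega] is relatively
compact as soon as [rnorm (u - v)], for [u] and [v] in [Omega], is controlled by
finitely many scalar products [<u - v, w>] up to an arbitrarily small error. If
the coefficients [phi pi w u] are tight, then up to a small error
[rnorm (u - v)] is bounded by the L^2 norm of [<u - v, g s w>] over a compact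
set of parameters [s]; there [s |-> g s w] has a compact image, and finite nets
of this image give the control ([relatively_compact_of_tight_phi]). If [Omega]
is tight for the symbolic calculus, the operators involved are Hilbert-Schmidt,
hence limits in norm of operators of finite rank, for which the control is
evident ([relatively_compact_of_tight_operators]).

Conversely, let [Omega] be relatively compact. The L^2 mass of [phi pi w u] far
away is small for each [u], hence uniformly over [Omega]
([tight_phi_of_relatively_compact]). The maps [adjoint (pi s)] are bounded
locally uniformly in [s] by the uniform boundedness principle, so their strong
continuity is uniform over [Omega] ([adjoint_equicontinuous]). At the point
[s1], where [adjoint (pi s1)] is the identity, this equicontinuity gives back
tightness for the symbolic calculus: for a bump [f] of integral 1 concentrated
near [s1], the operator with symbol [f] averages the maps [adjoint (pi s)] with
[s] close to [s1], so it moves the points of [Omega] by little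
([Re_symbol_le], [tight_symbols_of_equicontinuous]).

A nonzero [w] exists because [s1] belongs to the support of [mu]: L^2 is not
zero, so neither is [H] ([exists_nonzero]). *)

Set Implicit Arguments.
Unset Strict Implicit.
Unset Printing Implicit Defensive.

Import Order.TTheory GRing.Theory Num.Def Num.Theory.
Import numFieldNormedType.Exports.

Local Open Scope classical_set_scope.
Local Open Scope ring_scope.

(** * Real-valued norms and inner products *)

Section real_norm.
Variables (R : realType) (V : normedZmodType R[i]).
Implicit Types x y z : V.

Lemma normE x : `|x| = (rnorm x)%:C%C.
Proof. by rewrite /rnorm RRe_real. Qed.

Lemma rnorm_ge0 x : 0 <= rnorm x.
Proof. by rewrite -lecR -normE normr_ge0. Qed.

Lemma rnorm0 : rnorm (0 : V) = 0.
Proof. by rewrite /rnorm normr0. Qed.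

Lemma rnorm_eq0 x : (rnorm x == 0) = (x == 0).
Proof. by rewrite -(inj_eq (@complexI _)) -normE normr_eq0. Qed.

Lemma rnorm_gt0 x : (0 < rnorm x) = (x != 0).
Proof. by rewrite lt_neqAle eq_sym rnorm_eq0 rnorm_ge0 andbT. Qed.

Lemma rnormN x : rnorm (- x) = rnorm x.
Proof. by rewrite /rnorm normrN. Qed.

Lemma rnormBC x y : rnorm (x - y) = rnorm (y - x).
Proof. by rewrite -rnormN opprB. Qed.

Lemma rnormD x y : rnorm (x + y) <= rnorm x + rnorm y.
Proof. by rewrite -lecR rmorphD/= -!normE ler_normD. Qed.

Lemma rnormB x y : rnorm (x - y) <= rnorm x + rnorm y.
Proof. by rewrite -(rnormN y) rnormD. Qed.

Lemma sqr_rnormD_le x y :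
  rnorm (x + y) ^+ 2 <= 2 * rnorm x ^+ 2 + 2 * rnorm y ^+ 2.
Proof.
have : rnorm (x + y) ^+ 2 <= (rnorm x + rnorm y) ^+ 2.
  by rewrite ler_sqr ?nnegrE ?addr_ge0 ?rnorm_ge0// rnormD.
by have := sqr_ge0 (rnorm x - rnorm y); nra.
Qed.

Lemma rnorm_triangle y x z : rnorm (x - z) <= rnorm (x - y) + rnorm (y - z).
Proof. by rewrite -[x - z](subrKA y) rnormD. Qed.

Lemma rnorm_sum (I : Type) (s : seq I) (F : I -> V) :
  rnorm (\sum_(i <- s) F i) <= \sum_(i <- s) rnorm (F i).
Proof.
elim/big_ind2 : _ => [|a b c d ab cd|//]; first by rewrite rnorm0.
by rewrite (le_trans (rnormD _ _)) ?lerD.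
Qed.

Lemma rnorm_le x (e : R) : (rnorm x <= e) = (`|x| <= e%:C%C).
Proof. by rewrite normE lecR. Qed.

Lemma rnorm_lt x (e : R) : (rnorm x < e) = (`|x| < e%:C%C).
Proof. by rewrite normE ltcR. Qed.

End real_norm.

Section complex_modulus.
Variable R : realType.
Implicit Types a b : R[i].

Lemma rnormM a b : rnorm (a * b) = rnorm a * rnorm b.
Proof. by apply: (@complexI R); rewrite rmorphM/= -!normE normrM. Qed.

Lemma rnormZ (V : normedModType R[i]) a (x : V) :
  rnorm (a *: x) = rnorm a * rnorm x.
Proof. by apply: (@complexI R); rewrite rmorphM/= -!normE normrZ. Qed.

Lemma conjC_real_complex (r : R) : (r%:C%C)^* = r%:C%C :> R[i].
Proof. exact: conjc_real. Qed.

Lemma rnorm_real (r : R) : rnorm r%:C%C = `|r|.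
Proof.
by apply: (@complexI R); rewrite -normE normc_def/= expr0n addr0 sqrtr_sqr.
Qed.

Lemma sqr_rnorm a : rnorm a ^+ 2 = complex.Re a ^+ 2 + complex.Im a ^+ 2.
Proof. by apply: (@complexI R); rewrite add_Re2_Im2 normE rmorphXn. Qed.

Lemma rnormE a : rnorm a = sqrtr (complex.Re a ^+ 2 + complex.Im a ^+ 2).
Proof. by rewrite -sqr_rnorm sqrtr_sqr ger0_norm ?rnorm_ge0. Qed.

Lemma Re_le_rnorm a : `|complex.Re a| <= rnorm a.
Proof. by rewrite rnormE -sqrtr_sqr ler_wsqrtr// lerDl sqr_ge0. Qed.

Lemma Im_le_rnorm a : `|complex.Im a| <= rnorm a.
Proof. by rewrite rnormE -sqrtr_sqr ler_wsqrtr// lerDr sqr_ge0. Qed.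

Lemma rnorm_le_ReIm a : rnorm a <= `|complex.Re a| + `|complex.Im a|.
Proof.
rewrite -ler_sqr ?nnegrE ?rnorm_ge0 ?addr_ge0// sqr_rnorm.
rewrite -(real_normK (num_real (complex.Re a))).
rewrite -(real_normK (num_real (complex.Im a))).
by rewrite sqrrD lerD2r lerDl mulrn_wge0 // mulr_ge0.
Qed.

End complex_modulus.

Section rnorm_topology.
Variables (R : realType).

Lemma near_rnorm (V : normedModType R[i]) (x : V) (e : R) : 0 < e ->
  \forall y \near x, rnorm (y - x) <= e.
Proof.
move=> e0; have e0' : 0 < e%:C%C by rewrite ltcR.
have /cvgrPdist_le/(_ _ e0') : id @ x --> x by exact: cvg_id.
by apply: filterS => y; rewrite rnorm_le distrC.
Qed.

Lemma cvg_rnormP (V : normedModType R[i]) (T : Type) (F : set_system T)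
    {FF : Filter F} (f : T -> V) (l : V) :
  f @ F --> l <-> forall e : R, 0 < e -> \forall t \near F, rnorm (f t - l) <= e.
Proof.
split=> [fl e e0|fl].
  by apply: (fl [set y | rnorm (y - l) <= e]); exact: near_rnorm.
apply/cvgrPdist_le => e e0; move: (fl (complex.Re e)).
have eE : e = (complex.Re e)%:C%C by rewrite RRe_real ?gtr0_real.
rewrite -ltcR -eE => /(_ e0); apply: filterS => t.
by rewrite rnorm_le -eE distrC.
Qed.

(** Completeness of a normed space over the complex numbers, with the entourages
restated through real radii. *)
Lemma cauchy_rnorm (V : completeNormedModType R[i]) (F : set_system V)
    {FF : ProperFilter F} :
  (forall e : R, 0 < e -> exists x, F [set y | rnorm (y - x) <= e]) ->
  exists l : V, F --> l.
Proof.
move=> cF; apply/cvg_ex; apply/cauchy_cvgP; apply/cauchy_exP => e e0.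
have eE : e = (complex.Re e)%:C%C by rewrite RRe_real ?gtr0_real.
have re0 : 0 < complex.Re e by rewrite -ltcR -eE.
have [x Fx] := cF (complex.Re e / 2) ltac:(by rewrite divr_gt0).
exists x; rewrite /fmapE -ball_normE; apply: filterS Fx => y /= xy.
rewrite /= eE distrC -rnorm_lt (le_lt_trans xy)//.
by rewrite ltr_pdivrMr// ltr_pMr// ltr1n.
Qed.

End rnorm_topology.

Section inner_product.
Variables (R : realType) (H : hilbertType R).
Implicit Types u v w : H.

Lemma hdotDl u v w : hdot (u + v) w = hdot u w + hdot v w.
Proof. exact: linearDl. Qed.
Lemma hdotDr u v w : hdot u (v + w) = hdot u v + hdot u w.
Proof. exact: linearDr. Qed.
Lemma hdotBl u v w : hdot (u - v) w = hdot u w - hdot v w.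
Proof. exact: linearBl. Qed.
Lemma hdotBr u v w : hdot u (v - w) = hdot u v - hdot u w.
Proof. exact: linearBr. Qed.
Lemma hdotZl a u w : hdot (a *: u) w = a * hdot u w.
Proof. by rewrite linearZl. Qed.
Lemma hdotZr a u w : hdot u (a *: w) = a^* * hdot u w.
Proof. by rewrite linearZr. Qed.
Lemma hdot0l w : hdot (0 : H) w = 0.
Proof. exact: linear0l. Qed.
Lemma hdot0r w : hdot w (0 : H) = 0.
Proof. exact: linear0r. Qed.
Lemma hdotC u v : hdot u v = (hdot v u)^*.
Proof. by rewrite hermC expr0 mul1r. Qed.

Lemma rnorm_sqr u : (rnorm u ^+ 2)%:C%C = hdot u u.
Proof. by rewrite hdot_norm normE rmorphXn. Qed.

Lemma Re_hdotC u v : complex.Re (hdot u v) = complex.Re (hdot v u).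
Proof. by rewrite hdotC; case: (hdot v u). Qed.

Lemma sqr_rnormD u v :
  rnorm (u + v) ^+ 2 = rnorm u ^+ 2 + rnorm v ^+ 2 + 2 * complex.Re (hdot u v).
Proof.
have E (x : H) : rnorm x ^+ 2 = complex.Re (hdot x x).
  by rewrite -[LHS]/(complex.Re (_%:C%C)) rnorm_sqr.
rewrite !E hdotDl !hdotDr.
have := Re_hdotC u v.
case: (hdot u v) (hdot v u) (hdot u u) (hdot v v) => a b [c d] [e f] [g h] /= ->.
ring.
Qed.

Lemma sqr_rnormB u v :
  rnorm (u - v) ^+ 2 = rnorm u ^+ 2 + rnorm v ^+ 2 - 2 * complex.Re (hdot u v).
Proof.
rewrite sqr_rnormD rnormN -scaleN1r hdotZr rmorphN rmorph1 mulN1r.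
by case: (hdot u v) => a b/=; rewrite mulrN.
Qed.

(** Cauchy-Schwarz: expand the squared norm of [u - c *: v], where [c *: v] is
the orthogonal projection of [u] onto the line of [v]. *)
Lemma rnorm_hdot u v : rnorm (hdot u v) <= rnorm u * rnorm v.
Proof.
have [->|v0] := eqVneq v 0; first by rewrite hdot0r !rnorm0 mulr0.
have nv : 0 < rnorm v by rewrite rnorm_gt0.
set z := hdot u v; pose c := z / (rnorm v ^+ 2)%:C%C.
have : 0 <= rnorm (u - c *: v) ^+ 2 by rewrite sqr_ge0.
rewrite sqr_rnormB rnormZ hdotZr -/z.
have -> : c^* * z = (rnorm z ^+ 2 / rnorm v ^+ 2)%:C%C.
  rewrite /c rmorphM fmorphV/= conjC_real_complex mulrAC.
  rewrite -[_^* * z]mulrC -normCK normE.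
  by rewrite -rmorphXn/= -fmorphV -rmorphM.
have -> : rnorm c = rnorm z / rnorm v ^+ 2.
  rewrite /c rnormM -fmorphV rnorm_real ger0_norm// invr_ge0 sqr_ge0//.
move=> /= h.
rewrite -ler_sqr ?nnegrE ?mulr_ge0 ?rnorm_ge0// exprMn -ler_pdivrMr ?exprn_gt0//.
rewrite -subr_ge0 (le_trans h)// le_eqVlt; apply/orP; left; apply/eqP.
by field; rewrite gt_eqF.
Qed.

Lemma Re_hdot_le u v : complex.Re (hdot u v) <= rnorm u * rnorm v.
Proof.
by rewrite (le_trans (ler_norm _))// (le_trans (Re_le_rnorm _))// rnorm_hdot.
Qed.

Lemma hdot_eq u v : (forall w, hdot w u = hdot w v) -> u = v.
Proof.
move=> uv; apply/eqP; rewrite -subr_eq0 -rnorm_eq0 -sqrf_eq0.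
by rewrite -(inj_eq (@complexI R)) rnorm_sqr hdotBr uv subrr.
Qed.

End inner_product.

(** * Riesz representation and adjoints *)

(** Used to remove an error term that is proportional to an arbitrarily small
[e]; the constant [c] is allowed to vanish. *)
Lemma ler_addeps (R : realFieldType) (x y c : R) : 0 <= c ->
  (forall e, 0 < e -> x <= y + c * e) -> x <= y.
Proof.
move=> c0 h; apply/ler_addgt0Pr => e e0.
have c1 : 0 < c + 1 by rewrite ltr_wpDl.
apply: (le_trans (h (e / (c + 1)) _)); first by rewrite divr_gt0.
by rewrite lerD2l mulrA ler_pdivrMr// mulrC ler_wpM2l ?(ltW e0)// lerDl.
Qed.

Lemma ler_sqrD_le (R : realDomainType) (x p q : R) : 0 <= p -> 0 <= q ->
  x ^+ 2 <= p ^+ 2 + q ^+ 2 -> x <= p + q.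
Proof.
move=> p0 q0 xpq; have [x0|x0] := leP x 0; first by rewrite (le_trans x0) ?addr_ge0.
rewrite -ler_sqr ?nnegrE ?addr_ge0 ?(ltW x0)//.
by rewrite (le_trans xpq)// sqrrD lerD2r lerDl mulrn_wge0// mulr_ge0.
Qed.

Section riesz.
Variables (R : realType) (H : hilbertType R) (f : H -> R[i]).
Hypothesis f_linear : forall a u v, f (a *: u + v) = a * f u + f v.
Hypothesis f_bounded : exists B, forall u, rnorm (f u) <= B * rnorm u.

(** By completing the square, the minimizer of this functional is the vector
representing [f]. *)
Let q u := rnorm u ^+ 2 - 2 * complex.Re (f u).

Let fD u v : f (u + v) = f u + f v.
Proof. by rewrite -[u]scale1r f_linear mul1r scale1r. Qed.

Let f0 : f 0 = 0.
Proof. by apply: (addrI (f 0)); rewrite -fD !addr0. Qed.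

Let fZ a u : f (a *: u) = a * f u.
Proof. by rewrite -[a *: u]addr0 f_linear f0 addr0. Qed.

Let q_has_inf : has_inf (range q).
Proof.
split; first by exists (q 0); exists 0.
have [B fB] := f_bounded; exists (- B ^+ 2) => _ [u _ <-]; rewrite /q.
have := le_trans (Re_le_rnorm _) (fB u); have := ler_norm (complex.Re (f u)).
have := sqr_ge0 (rnorm u - B); nra.
Qed.

Let near_minimizer (e : R) : 0 < e -> exists u, q u <= inf (range q) + e.
Proof.
by move=> e0; have [_ [u _ <-] /ltW] := inf_adherent e0 q_has_inf; exists u.
Qed.

Let inf_le u : inf (range q) <= q u.
Proof. by apply: inf_lbound; [case: q_has_inf | exists u]. Qed.

(** The parallelogram identity compares [q u] and [q v] with the value of [q] at
the midpoint of [u] and [v], which is at least the infimum. *)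
Let minimizers_close (e : R) u v :
  q u <= inf (range q) + e -> q v <= inf (range q) + e ->
  rnorm (u - v) ^+ 2 <= 4 * e.
Proof.
have := inf_le (2^-1%:C%C *: (u + v)); rewrite /q fZ rnormZ fD rnorm_real.
rewrite gtr0_norm ?invr_gt0// exprMn sqr_rnormD sqr_rnormB.
case: (f u) (f v) => a b [c d] /=; lra.
Qed.

(** First variation of [q] at a near-minimizer: the step along [h] is the real
multiple of [h] that minimizes the resulting quadratic polynomial. *)
Let minimizer_almost_critical (e : R) u h : 0 < e ->
  q u <= inf (range q) + e ^+ 2 ->
  complex.Re (hdot h u - f h) <= e * rnorm h.
Proof.
move=> e0 qu; set g := complex.Re _.
have [g0|g0] := leP g 0.
  by rewrite (le_trans g0)// mulr_ge0 ?(ltW e0) ?rnorm_ge0.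
have [h0|h0] := eqVneq (rnorm h) 0.
  have h00 : h = 0 by apply/eqP; rewrite -rnorm_eq0 h0.
  by move: g0; rewrite /g h00 hdot0l f0 subrr /= ltxx.
have nh : 0 < rnorm h by rewrite lt_neqAle eq_sym h0 rnorm_ge0.
have := inf_le (u + (- g / rnorm h ^+ 2)%:C%C *: h).
rewrite /q fD fZ sqr_rnormD rnormZ rnorm_real hdotZr conjC_real_complex.
have -> : `|- g / rnorm h ^+ 2| = g / rnorm h ^+ 2.
  by rewrite mulNr normrN gtr0_norm// divr_gt0 ?exprn_gt0.
have gE : g = complex.Re (hdot u h) - complex.Re (f h).
  by rewrite /g Re_hdotC; move: (hdot h u) (f h) => [? ?] [? ?].
have ReD (x y : R[i]) : complex.Re (x + y) = complex.Re x + complex.Re y.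
  by case: x y => ? ? [].
have ReZ (t : R) (z : R[i]) : complex.Re (t%:C%C * z) = t * complex.Re z.
  by case: z => ? ? /=; rewrite mul0r subr0.
rewrite ReD !ReZ => qm.
have : g ^+ 2 / rnorm h ^+ 2 <= e ^+ 2.
  move: qm qu; rewrite /q.
  have -> : (g / rnorm h ^+ 2 * rnorm h) ^+ 2 = g ^+ 2 / rnorm h ^+ 2 by field.
  have -> : complex.Re (hdot u h) = g + complex.Re (f h) by rewrite gE subrK.
  have -> : - g / rnorm h ^+ 2 * (g + complex.Re (f h)) =
    - (g ^+ 2 / rnorm h ^+ 2) + - g / rnorm h ^+ 2 * complex.Re (f h) by field.
  lra.
rewrite ler_pdivrMr ?exprn_gt0// -exprMn ler_sqr// nnegrE ?(ltW g0)//.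
by rewrite mulr_ge0 ?ltW.
Qed.

(** Near-minimizers of [q] form a Cauchy filter; at its limit [l] the first
variation [Re (<h, l> - f h)] vanishes in every direction [h]. *)
Lemma riesz : exists w, forall u, f u = hdot u w.
Proof.
pose m := inf (range q).
pose F := filter_from [set e : R | 0 < e] (fun e => [set u | q u <= m + e ^+ 2]).
have FF : ProperFilter F.
  apply: filter_from_proper; last first.
    by move=> e /= e0; apply: near_minimizer; rewrite exprn_gt0.
  apply: filter_from_filter; first by exists 1 => /=.
  move=> a b /= a0 b0; exists (Num.min a b); first by rewrite /= lt_min a0.
  have le2 (x y : R) : 0 < x -> x <= y -> m + x ^+ 2 <= m + y ^+ 2.
    by move=> x0 xy; rewrite lerD2l ler_sqr ?nnegrE ?(ltW x0) ?(le_trans (ltW x0)).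
  move=> u /= qu; split; apply: (le_trans qu); apply: le2;
    by rewrite ?lt_min ?a0 ?b0// ge_min lexx ?orbT.
have [l Fl] : exists l : H, F --> l.
  apply: cauchy_rnorm => e e0.
  have e2 : 0 < (e / 2) by rewrite divr_gt0.
  have [x qx] := near_minimizer (exprn_gt0 2 e2).
  exists x; exists (e / 2) => // y /= qy.
  rewrite -ler_sqr ?nnegrE ?rnorm_ge0 ?(ltW e0)//.
  by rewrite (le_trans (minimizers_close qy qx))// le_eqVlt; apply/orP; left;
    apply/eqP; field.
exists l => u; apply/eqP; rewrite eq_sym -subr_eq0.
suff Re_le0 h : complex.Re (hdot h l - f h) <= 0.
  (* This direction turns the real part into the squared modulus of [z]. *)
  set z := hdot u l - f u; have := Re_le0 (z^* *: u).
  rewrite hdotZl fZ -mulrBr -/z mulrC -normCK normE -rmorphXn/= => z0.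
  by rewrite -rnorm_eq0 -sqrf_eq0 eq_le z0 sqr_ge0.
apply: (@ler_addeps _ _ _ (2 * rnorm h)) => [|e e0].
  by rewrite mulr_ge0 ?rnorm_ge0.
have Fe : F [set v | rnorm (v - l) <= e] by apply: Fl; exact: near_rnorm.
have Fq : F [set v | q v <= m + e ^+ 2] by exists e.
have [v [/= vl qv]] := filter_ex (filterI Fe Fq).
have := minimizer_almost_critical h e0 qv.
have := Re_hdot_le h (l - v); rewrite hdotBr rnormBC.
have := ler_wpM2l (rnorm_ge0 h) vl.
move: (hdot h l) (hdot h v) (f h) => [? ?] [? ?] [? ?] /=; lra.
Qed.

End riesz.

Section adjoint.
Variables (R : realType) (H : hilbertType R).
Implicit Types T : bounded_op H.

Lemma bounded_op_le T : exists2 B, 0 <= B & forall u, rnorm (T u) <= B * rnorm u.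
Proof.
have [M [Mr TM]] := (linear_boundedP (bounded_op_linear T)).1 (bounded_opP T).
have /RRe_real ME := Mr; pose B := Num.max 0 (complex.Re M) + 1.
have MB : M < B%:C%C by rewrite -ME ltcR /B ltr_pwDr// le_max lexx orbT.
exists B => [|u]; first by rewrite /B addr_ge0// le_max lexx.
by have := TM _ MB u; rewrite !normE -rmorphM/= lecR.
Qed.

(** The defining property of [adjoint]: the Riesz representation makes the set
from which [adjoint] chooses a vector nonempty. *)
Lemma adjointE T u v : hdot (T u) v = hdot u (adjoint T v).
Proof.
rewrite /adjoint; case: xgetP => [w _ /= //|no_adjoint].
have [||w Tw] := @riesz R H (fun u => hdot (T u) v).
- by move=> a x y; rewrite linearP hdotDl hdotZl.
- have [B B0 TB] := bounded_op_le T; exists (B * rnorm v) => x.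
  by rewrite (le_trans (rnorm_hdot _ _))// mulrAC ler_wpM2r ?rnorm_ge0.
by case: (no_adjoint w).
Qed.

Lemma adjoint_linear T a u v :
  adjoint T (a *: u + v) = a *: adjoint T u + adjoint T v.
Proof.
by apply: hdot_eq => w; rewrite -adjointE !hdotDr !hdotZr -!adjointE.
Qed.

Lemma adjointB T u v : adjoint T (u - v) = adjoint T u - adjoint T v.
Proof. by rewrite addrC -scaleN1r adjoint_linear scaleN1r addrC. Qed.

(** From [||T^* v||^2 = <T (T^* v), v>], the bound of [T] also
bounds its adjoint. *)
Lemma adjoint_bounded T : exists B, forall u, rnorm (adjoint T u) <= B * rnorm u.
Proof.
have [B B0 TB] := bounded_op_le T; exists B => v; set w := adjoint T v.
have [w0|w0] := eqVneq (rnorm w) 0; first by rewrite w0 mulr_ge0 ?rnorm_ge0.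
have nw : 0 < rnorm w by rewrite lt_neqAle eq_sym w0 rnorm_ge0.
rewrite -(ler_pM2l nw) -expr2.
have -> : rnorm w ^+ 2 = complex.Re (hdot (T w) v).
  by rewrite adjointE -rnorm_sqr.
rewrite (le_trans (Re_hdot_le _ _))// mulrA ler_wpM2r ?rnorm_ge0//.
by rewrite mulrC.
Qed.

End adjoint.

(** * Uniform boundedness and a compactness criterion *)

Section uniform_boundedness.
Variables (R : realType) (H : hilbertType R).
Variables (T : Type) (C : set T) (g : T -> H -> H).
Hypothesis g_linear : forall s a u v, g s (a *: u + v) = a *: g s u + g s v.
Hypothesis g_bounded : forall s, exists B, forall u, rnorm (g s u) <= B * rnorm u.
Hypothesis g_pointwise : forall u, exists M, forall s, C s -> rnorm (g s u) <= M.

Let gB s u v : g s (u - v) = g s u - g s v.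
Proof. by rewrite addrC -scaleN1r g_linear scaleN1r addrC. Qed.

Let g0 s : g s 0 = 0.
Proof. by rewrite -[X in g s X](subrr 0) gB subrr. Qed.

Let gZ s a u : g s (a *: u) = a *: g s u.
Proof. by rewrite -[a *: u]addr0 g_linear g0 addr0. Qed.

Let bounded_on_ball (x : H) (r : R) (M : R) :=
  forall s, C s -> forall y, rnorm (y - x) <= r -> rnorm (g s y) <= M.

Let ball_to_unit x r M : 0 < r -> bounded_on_ball x r M ->
  exists2 M', 0 <= M' & forall s, C s -> forall u, rnorm (g s u) <= M' * rnorm u.
Proof.
move=> r0 gM; exists (2 * `|M| / r) => [|s Cs u].
  by rewrite divr_ge0 ?(ltW r0)// mulr_ge0.
have [->|u0] := eqVneq u 0; first by rewrite g0 !rnorm0 mulr0.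
have nu : 0 < rnorm u by rewrite rnorm_gt0.
pose y := x + (r / rnorm u)%:C%C *: u.
have yx : y - x = (r / rnorm u)%:C%C *: u by rewrite /y addrC addKr.
have yxr : rnorm (y - x) <= r.
  by rewrite yx rnormZ rnorm_real gtr0_norm ?divr_gt0// divfK// gt_eqF.
have := congr1 (g s) yx; rewrite gB gZ => /(congr1 (@rnorm _ _)).
rewrite rnormZ rnorm_real gtr0_norm ?divr_gt0// => guE.
have : r / rnorm u * rnorm (g s u) <= 2 * `|M|.
  rewrite -guE (le_trans (rnormB _ _))// mulr_natl mulr2n lerD//.
    by rewrite (le_trans (gM _ Cs _ yxr))// ler_norm.
  rewrite (le_trans (gM _ Cs _ _))// ?ler_norm//.
  by rewrite subrr rnorm0 ltW.
move=> gu; rewrite (_ : rnorm (g s u) = r / rnorm u * rnorm (g s u) / r * rnorm u).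
  by rewrite ler_wpM2r ?rnorm_ge0// ler_wpM2r// invr_ge0 ltW.
by field; rewrite !gt_eqF.
Qed.

(** Banach-Steinhaus. If the family were unbounded on every ball, one could
choose nested balls [B_n], with radii tending to 0, and indices [s_n] such that
[g s_n] has norm at least [n] on the whole of [B_n]; the common point of these
balls would contradict the pointwise bound. *)
Lemma uniform_boundedness :
  exists2 M, 0 <= M & forall s, C s -> forall u, rnorm (g s u) <= M * rnorm u.
Proof.
have [[x [r [M [r0 gM]]]]|unbounded] :=
  pselect (exists x r M, 0 < r /\ bounded_on_ball x r M).
  exact: ball_to_unit r0 gM.
exfalso.
pose P n (p q : H * R) := 0 < p.2 -> [/\ 0 < q.2, q.2 <= n.+1%:R^-1,
  rnorm (q.1 - p.1) + q.2 <= p.2 & exists2 s, C s &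
  forall z, rnorm (z - q.1) <= q.2 -> n%:R <= rnorm (g s z)].
have /choice[step stepP] : forall np : nat * (H * R), exists q, P np.1 np.2 q.
  move=> [n [x r]]; have [r0|r0] := ltP 0 r; last first.
    by exists 0; rewrite /P ltNge r0.
  have r20 : 0 < r / 2 by rewrite divr_gt0.
  have [s [Cs [y [yx ny]]]] : exists s, C s /\ exists y, rnorm (y - x) <= r / 2 /\
      n%:R < rnorm (g s y).
    apply: contrapT => no; apply: unbounded; exists x, (r / 2), n%:R; split => //.
    move=> s Cs y yx; rewrite leNgt; apply/negP => ny.
    by apply: no; exists s; split => //; exists y.
  have [B gB'] := g_bounded s.
  pose d := (rnorm (g s y) - n%:R) / (`|B| + 1).
  have d0 : 0 < d by rewrite divr_gt0 ?subr_gt0// ltr_wpDl.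
  (* On a ball of radius at most [d] around [y], the linear bound [B] of [g s]
  keeps its norm above [n]. *)
  exists (y, Num.min d (Num.min (r / 2) n.+1%:R^-1)) => _ /=; split.
  - by rewrite !lt_min d0 r20 invr_gt0 ltr0n.
  - by rewrite !ge_min lexx !orbT.
  - rewrite [leRHS]splitr lerD// !ge_min lexx ?orbT//.
  - exists s => // z zy.
    have zd : rnorm (z - y) <= d by rewrite (le_trans zy)// ge_min lexx.
    have : rnorm (g s y) <= rnorm (g s z) + rnorm (g s (z - y)).
      rewrite -[g s y](addrNK (g s z)) gB addrC.
      by rewrite (le_trans (rnormD _ _))// lerD2l rnormBC.
    have : rnorm (g s (z - y)) <= rnorm (g s y) - n%:R.
      have -> : rnorm (g s y) - n%:R = (`|B| + 1) * d.
        by rewrite /d mulrC divfK// gt_eqF// ltr_wpDl.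
      have := gB' (z - y); have := ler_wpM2r (rnorm_ge0 (z - y)) (ler_norm B).
      have := ler_wpM2l (normr_ge0 B) zd; rewrite mulrDl mul1r; lra.
    lra.
pose p := fix p n := if n is m.+1 then step (m, p m) else (0 : H, 1 : R).
have p0 n : 0 < (p n).2.
  by elim: n => [|n IH] /=; [exact: ltr01|case: (stepP (n, p n) IH)].
have p_nested n k : rnorm ((p (n + k)%N).1 - (p n).1) + (p (n + k)%N).2 <= (p n).2.
  elim: k => [|k IH]; first by rewrite addn0 subrr rnorm0 add0r.
  rewrite addnS; have [_ _ pp _] := stepP ((n + k)%N, p (n + k)%N) (p0 _).
  rewrite -/(p (n + k).+1) /= in pp *.
  have := rnorm_triangle (p (n + k)%N).1 (step ((n + k)%N, p (n + k)%N)).1 (p n).1.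
  lra.
have p_close n m : (n <= m)%N -> rnorm ((p m).1 - (p n).1) <= (p n).2.
  move=> /subnKC <-; have := p_nested n (m - n)%N; have := p0 (n + (m - n))%N.
  lra.
have [l pl] : exists l : H, (fun n => (p n).1) @ \oo --> l.
  apply: cauchy_rnorm => e e0.
  pose N := truncn e^-1; exists (p N.+1).1; exists N.+1 => // m /= Nm.
  rewrite (le_trans (p_close _ _ Nm))//.
  have [_ pN _ _] := stepP (N, p N) (p0 N).
  by rewrite (le_trans pN)// invf_ple ?posrE// ltW// truncnS_gt.
have l_close n : rnorm (l - (p n).1) <= (p n).2.
  apply/ler_addgt0Pr => e e0.
  have /cvg_rnormP/(_ e e0) [N _ pN] := pl.
  have := pN (maxn N n) (leq_maxl _ _); have := p_close n _ (leq_maxr N n).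
  have := rnorm_triangle (p (maxn N n)).1 l (p n).1.
  rewrite (rnormBC l (p (maxn N n)).1) /=; lra.
have [M gM] := g_pointwise l.
pose n := (truncn M).+1.
have [_ _ _ [s Cs]] := stepP (n, p n) (p0 n).
move=> /(_ l (l_close n.+1)); rewrite leNgt => /negP; apply.
by rewrite (le_lt_trans (gM s Cs))// truncnS_gt.
Qed.

End uniform_boundedness.

Section compactness_criterion.
Variables (R : realType) (H : hilbertType R).

(** A cluster point of an ultrafilter is a limit, and segments are compact. *)
Lemma bounded_ultra_cvg (T : Type) (F : set_system T) (f : T -> R) (B : R) :
  UltraFilter F -> F [set t | `|f t| <= B] ->
  exists a : R, forall e : R, 0 < e -> F [set t | `|f t - a| <= e].
Proof.
move=> UF FB.
have fB : F [set t | f t \in `[- B, B]].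
  by apply: filterS FB => t /=; rewrite in_itv/= ler_norml.
have [a [_ fa]] := @segment_compact R (- B) B (f @ F) _ fB.
exists a => e e0.
have [//|Fn] := in_ultra_setVsetC [set t | `|f t - a| <= e] UF.
have [] := fa [set x | ~ `|x - a| <= e] [set x | `|x - a| <= e].
- exact: Fn.
- have /cvgrPdist_le/(_ e e0) : id @ a --> a by exact: cvg_id.
  by apply: filterS => x; rewrite distrC.
- by move=> x [].
Qed.

Variables (F : set_system H) (B : R).
Hypotheses (UF : UltraFilter F) (FB : F [set u | rnorm u <= B]).

Lemma ultra_weakly_cvg w : exists z : R[i],
  forall e, 0 < e -> F [set u | rnorm (hdot u w - z) <= e].
Proof.
have FBw : F [set u | rnorm (hdot u w) <= B * rnorm w].
  apply: filterS FB => u /= uB.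
  by rewrite (le_trans (rnorm_hdot _ _))// ler_wpM2r ?rnorm_ge0.
have [a Fa] := bounded_ultra_cvg UF
  (filterS (fun u h => le_trans (Re_le_rnorm _) h) FBw).
have [b Fb] := bounded_ultra_cvg UF
  (filterS (fun u h => le_trans (Im_le_rnorm _) h) FBw).
exists (Complex a b) => e e0; have e20 : 0 < e / 2 by rewrite divr_gt0.
apply: filterS (filterI (Fa _ e20) (Fb _ e20)) => u /=.
case: (hdot u w) => x y [/= xa yb].
by rewrite (le_trans (rnorm_le_ReIm _))//= [leRHS]splitr lerD.
Qed.

Lemma ultra_weakly_cauchy (s : seq H) (e : R) : 0 < e ->
  exists2 A, F A & forall u v, A u -> A v ->
    \sum_(w <- s) rnorm (hdot (u - v) w) <= e.
Proof.
elim: s e => [|w s IH] e e0.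
  by exists setT; [exact: filterT|move=> u v _ _; rewrite big_nil ltW].
have e20 : 0 < e / 2 by rewrite divr_gt0.
have [A FA As] := IH _ e20.
have [z Fz] := ultra_weakly_cvg w.
exists (A `&` [set u | rnorm (hdot u w - z) <= e / 4]).
  by apply: filterI => //; apply: Fz; rewrite divr_gt0.
move=> u v [Au /= uz] [Av /= vz]; rewrite big_cons.
have := As u v Au Av; have := rnorm_triangle z (hdot u w) (hdot v w).
rewrite hdotBl (rnormBC z); lra.
Qed.

End compactness_criterion.

Lemma closure_rnormP (R : realType) (V : normedModType R[i]) (A : set V) u :
  closure A u -> forall e, 0 < e -> exists2 v, A v & rnorm (v - u) <= e.
Proof.
by move=> Au e e0; have [v [Av vu]] := Au _ (near_rnorm u e0); exists v.
Qed.

(** On a bounded set every ultrafilter is weakly Cauchy; a control of the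
norm by finitely many scalar products, up to an arbitrarily small error, makes
it Cauchy in norm. The inequality is closed in [(u, v)], hence it passes from [Omega] to its closure. *)
Lemma relatively_compact_of_weak_control (R : realType) (H : hilbertType R)
    (Omega : set H) (B : R) : (forall u, Omega u -> rnorm u <= B) ->
  (forall e : R, 0 < e -> exists s : seq H, exists2 c : R, 0 <= c &
     forall u v, Omega u -> Omega v ->
       rnorm (u - v) <= e + c * \sum_(w <- s) rnorm (hdot (u - v) w)) ->
  compact (closure Omega).
Proof.
move=> OmegaB control; rewrite compact_ultra => F UF FOmega.
have FB : F [set u | rnorm u <= B + 1].
  apply: filterS FOmega => u /closure_rnormP/(_ 1 ltr01)[v Ov vu] /=.
  have := OmegaB v Ov; have := rnormB v (v - u); rewrite subKr; lra.
have [l Fl] : exists l : H, F --> l; last first.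
  exists l; split => //.
  exact: (@closed_cvg _ _ F _ id (closure Omega) (@closed_closure _ Omega)
    FOmega l Fl).
apply: cauchy_rnorm => e e0.
have [s [c c0 sc]] := control (e / 2) (divr_gt0 e0 (ltr0Sn R 1)).
pose d := e / 2 / (c + 1).
have d0 : 0 < d by rewrite !divr_gt0// ltr_wpDl.
have [A FA As] := ultra_weakly_cauchy UF FB s d0.
have [v [Av Ov]] := filter_ex (filterI FA FOmega).
exists v; apply: filterS (filterI FA FOmega) => u [Au Ou] /=.
set S := \sum_(w <- s) rnorm w.
have S0 : 0 <= S by apply: sumr_ge0 => w _; exact: rnorm_ge0.
(* [u] and [v] only belong to the closure: replace them by points of [Omega] at
distance [r], at the cost of an error proportional to [r]. *)
apply: (@ler_addeps _ _ _ (2 + c * (2 * S))) => [|r r0].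
  by rewrite addr_ge0// mulr_ge0// mulr_ge0.
have [u' Ou' uu'] := closure_rnormP Ou r0.
have [v' Ov' vv'] := closure_rnormP Ov r0.
have uv : rnorm ((u' - v') - (u - v)) <= 2 * r.
  rewrite (_ : _ - _ = (u' - u) - (v' - v)) ?(le_trans (rnormB _ _))//; first lra.
  by rewrite !opprB addrACA [RHS]addrACA [- v' - u]addrC.
have step1 : rnorm (u - v) <= rnorm (u' - v') + 2 * r.
  have := rnorm_triangle (u' - v') (u - v) 0; rewrite !subr0 (rnormBC (u - v)); lra.
have step2 : \sum_(w <- s) rnorm (hdot (u' - v') w) <= d + 2 * r * S.
  apply: le_trans (_ : \sum_(w <- s) (rnorm (hdot (u - v) w) + 2 * r * rnorm w) <= _).
    apply: ler_sum => w _.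
    have := rnorm_triangle (hdot (u - v) w) (hdot (u' - v') w) 0.
    rewrite !subr0 -hdotBl; have := rnorm_hdot (u' - v' - (u - v)) w.
    have := ler_wpM2r (rnorm_ge0 w) uv; lra.
  by rewrite big_split/= -mulr_sumr lerD// As.
have := sc _ _ Ou' Ov'; have := ler_wpM2l c0 step2.
have : c * d <= e / 2.
  rewrite /d mulrCA ler_piMr//; first by rewrite divr_ge0 ?(ltW e0).
  by rewrite ler_pdivrMr ?ltr_wpDl// mul1r lerDl.
rewrite !mulrDr; lra.
Qed.

(** * Integration of continuous functions and bumps *)

Section borel_integration.
Variables (R : realType) (T : ptopologicalType).
Variable mu : {measure set (borel T) -> \bar R}.
Implicit Types (D : set (borel T)) (h : borel T -> R).

Lemma open_borel (U : set T) : open U -> measurable (U : set (borel T)).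
Proof. by move=> oU; exact: sub_sigma_algebra. Qed.

Lemma closed_borel (C : set T) : closed C -> measurable (C : set (borel T)).
Proof.
move=> cC; rewrite -[C]setCK; apply: measurableC; apply: open_borel.
exact: closed_openC.
Qed.

Lemma continuous_borel (h : T -> R) :
  continuous h -> measurable_fun [set: borel T] (h : borel T -> R).
Proof.
move=> ch; apply: (measurability _ (RGenOpens.measurableE R)).
move=> _ [_ [a [b ->] <-]]; rewrite setTI; apply: open_borel.
by apply: (@open_comp T R h) => [s _|]; [exact: ch|exact: interval_open].
Qed.

Lemma ge0_integral_lin D h1 h2 (c1 c2 : R) :
  measurable D -> measurable_fun setT h1 -> measurable_fun setT h2 ->
  (forall s, 0 <= h1 s) -> (forall s, 0 <= h2 s) -> 0 <= c1 -> 0 <= c2 ->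
  (\int[mu]_(s in D) (c1 * h1 s + c2 * h2 s)%:E =
   c1%:E * \int[mu]_(s in D) (h1 s)%:E + c2%:E * \int[mu]_(s in D) (h2 s)%:E)%E.
Proof.
move=> mD m1 m2 h1_ge0 h2_ge0 c1_ge0 c2_ge0.
have mE h : measurable_fun setT h -> measurable_fun D (EFin \o h).
  by move=> mh; apply/measurable_EFinP; apply: measurable_funTS.
have mZ c h : measurable_fun setT h -> measurable_fun D (EFin \o (fun s => c * h s)).
  by move=> mh; apply: mE; apply: measurable_funM => //; exact: measurable_cst.
under eq_integral do rewrite EFinD.
rewrite ge0_integralD//; first last.
- exact: mZ.
- by move=> s _; rewrite lee_fin mulr_ge0.
- exact: mZ.
- by move=> s _; rewrite lee_fin mulr_ge0.
under eq_integral do rewrite EFinM.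
under [X in (_ + X)%E]eq_integral do rewrite EFinM.
rewrite (ge0_integralZl_EFin _ mD _ (mE _ m1))//; last first.
  by move=> s _; rewrite lee_fin.
by rewrite (ge0_integralZl_EFin _ mD _ (mE _ m2))// => s _; rewrite lee_fin.
Qed.

Lemma le_integral_lin D h h1 h2 (c1 c2 : R) :
  measurable D -> measurable_fun setT h ->
  measurable_fun setT h1 -> measurable_fun setT h2 ->
  (forall s, 0 <= h s) ->
  (forall s, 0 <= h1 s) -> (forall s, 0 <= h2 s) -> 0 <= c1 -> 0 <= c2 ->
  (forall s, D s -> h s <= c1 * h1 s + c2 * h2 s) ->
  (\int[mu]_(s in D) (h s)%:E <=
   c1%:E * \int[mu]_(s in D) (h1 s)%:E + c2%:E * \int[mu]_(s in D) (h2 s)%:E)%E.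
Proof.
move=> mD mh m1 m2 h0 h10 h20 c10 c20 hle; rewrite -ge0_integral_lin//.
apply: ge0_le_integral => //.
- by move=> s _; rewrite lee_fin.
- by apply/measurable_EFinP; apply: measurable_funTS.
- apply/measurable_EFinP; apply: measurable_funTS.
  by apply: measurable_funD; apply: measurable_funM => //; exact: measurable_cst.
Qed.

Lemma integral_support D h : (forall s, ~ D s -> h s = 0) ->
  (\int[mu]_s (h s)%:E = \int[mu]_(s in D) (h s)%:E)%E.
Proof.
move=> hD; rewrite [RHS]integral_mkcond; apply: eq_integral => s _; rewrite patchE.
by case: ifPn => //; rewrite notin_setE => /hD ->.
Qed.

Lemma integral_bounded_support D h (c : R) :
  measurable D -> measurable_fun setT h -> (forall s, 0 <= h s) -> 0 <= c ->
  (forall s, D s -> h s <= c) -> (forall s, ~ D s -> h s = 0) ->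
  (\int[mu]_s (h s)%:E <= c%:E * mu D)%E.
Proof.
move=> mD mh h0 c0 hc hD.
rewrite (integral_support hD) -integral_cst//; apply: ge0_le_integral => //.
- by move=> s _; rewrite lee_fin.
- by apply/measurable_EFinP; apply: measurable_funTS.
Qed.

(** Monotone convergence along [F], read on the complements. *)
Lemma exhaustion_integral_tail (F : nat -> set T) h (M : R) :
  (forall n, measurable (F n : set (borel T))) -> nondecreasing_seq F ->
  \bigcup_n F n = setT -> measurable_fun setT h -> (forall s, 0 <= h s) ->
  (\int[mu]_s (h s)%:E = M%:E)%E ->
  forall e : R, 0 < e ->
    \forall n \near \oo, (\int[mu]_(s in ~` F n) (h s)%:E <= e%:E)%E.
Proof.
move=> mF ndF FT mh h0 hM e e0.
have mhE D : measurable_fun D (EFin \o h).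
  by apply/measurable_EFinP; exact: measurable_funTS.
have := @ge0_nondecreasing_set_cvg_integral _ (borel T) R F
  (fun s => (h s)%:E) mu ndF mF (fun i => mhE _).
rewrite FT hM => hcvg.
have {hcvg} cvF : (\int[mu]_(s in F n) (h s)%:E)%E @[n --> \oo] --> M%:E.
  by apply: hcvg => n s _; rewrite lee_fin.
have split_h n : (\int[mu]_(s in F n) (h s)%:E +
    \int[mu]_(s in ~` F n) (h s)%:E = M%:E)%E.
  rewrite -hM -(setUv (F n)) ge0_integral_setU//.
  - exact: measurableC.
  - by move=> s _; rewrite lee_fin.
  - by rewrite disj_set2E setICr.
have le_M n : (\int[mu]_(s in F n) (h s)%:E <= M%:E)%E.
  by rewrite -(split_h n) leeDl// integral_ge0// => s _; rewrite lee_fin.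
have : \forall n \near \oo, ((M - e)%:E < \int[mu]_(s in F n) (h s)%:E)%E.
  apply: (cvF [set x | ((M - e)%:E < x)%E]).
  apply: open_nbhs_nbhs; split; first exact: open_ereal_gt_ereal.
  by rewrite /= lte_fin ltrBlDr ltrDl.
apply: filterS => n; move: (split_h n) (le_M n).
have : (0 <= \int[mu]_(s in F n) (h s)%:E)%E.
  by apply: integral_ge0 => s _; rewrite lee_fin.
case: (\int[mu]_(s in F n) _)%E => // a; case: (\int[mu]_(s in ~` _) _)%E => // b.
rewrite -EFinD => _ [] <- _; rewrite lte_fin lee_fin; lra.
Qed.

(** [h] stays above [h s0 / 2] on a neighbourhood of [s0], whose measure is
positive. *)
Lemma integral_gt0_support h s0 :
  continuous (h : T -> R) -> (forall s, 0 <= h s) -> measure_support mu s0 ->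
  0 < h s0 -> (0 < \int[mu]_s (h s)%:E)%E.
Proof.
move=> ch h_ge0 supp_s0 hs0; pose V := [set s | h s0 / 2 < h s].
have oV : open V.
  exact: (@open_comp T R h [set x | h s0 / 2 < x] (fun s _ => ch s)
    (@open_gt _ _)).
have Vs0 : V s0 by rewrite /V /= ltr_pdivrMr// ltr_pMr// ltr1n.
have mV := open_borel oV; have mh := continuous_borel ch.
apply: (@lt_le_trans _ _ ((h s0 / 2)%:E * mu V)%E).
  by rewrite mule_gt0 ?lte_fin ?divr_gt0//; exact: supp_s0.
rewrite -integral_cst//.
apply: (@le_trans _ _ (\int[mu]_(s in V) (h s)%:E)%E).
  apply: ge0_le_integral => //.
  - by move=> s _; rewrite lee_fin divr_ge0 ?(ltW hs0).
  - by apply/measurable_EFinP; apply: measurable_funTS.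
  - by move=> s /ltW.
apply: ge0_subset_integral => //; first exact/measurable_EFinP.
by move=> s _; rewrite lee_fin.
Qed.

End borel_integration.

Section l2_norm.
Variables (R : realType) (T : ptopologicalType).
Variable mu : {measure set (borel T) -> \bar R}.
Implicit Types f : T -> R[i].

(** Working with the square of [l2norm] avoids both square roots and the
Minkowski inequality: the crude bound [|x + y|^2 <= 2 |x|^2 + 2 |y|^2] is enough
for all the estimates below. *)
Definition l2sqr f : \bar R := (\int[mu]_s (rnorm (f s) ^+ 2)%:E)%E.

Lemma l2normK f : (l2norm mu f * l2norm mu f = l2sqr f)%E.
Proof.
have l0 : (0 <= l2norm mu f)%E by exact: Lnorm_ge0.
have -> : (l2norm mu f * l2norm mu f = l2norm mu f `^ 2)%E.
  case: (l2norm mu f) l0 => [r||]//=; last first.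
    by move=> _; rewrite /poweR pnatr_eq0; exact: mulyy.
  by rewrite lee_fin => r0; rewrite powR_mulrn// expr2 EFinM.
rewrite /l2norm poweR_Lnorm ?pnatr_eq0//; apply: eq_integral => s _ /=.
by rewrite ger0_norm ?rnorm_ge0// powR_mulrn ?rnorm_ge0.
Qed.

Lemma l2norm_le f (e : R) : 0 <= e ->
  (l2norm mu f <= e%:E)%E = (l2sqr f <= (e ^+ 2)%:E)%E.
Proof.
move=> e0; rewrite -l2normK.
have : (0 <= l2norm mu f)%E by exact: Lnorm_ge0.
case: (l2norm mu f) => [r||]//.
by rewrite !lee_fin -expr2 => r0; rewrite ler_sqr.
Qed.

Lemma l2norm_eq f (e : R) : l2norm mu f = e%:E -> l2sqr f = (e ^+ 2)%:E.
Proof. by move=> fe; rewrite -l2normK fe -EFinM -expr2. Qed.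

Lemma l2norm_lty f : (l2sqr f < +oo)%E -> (l2norm mu f < +oo)%E.
Proof.
rewrite -l2normK.
have : (0 <= l2norm mu f)%E by exact: Lnorm_ge0.
by case: (l2norm mu f) => [r||]//= _; rewrite ?ltry.
Qed.

End l2_norm.

Section bump.
Variables (R : realType) (T : ptopologicalType).
Hypotheses (T_hausdorff : hausdorff_space T) (T_lc : locally_compact [set: T]).

(** Urysohn's lemma in the one-point compactification [X], which is normal,
separates [C] from the complement of [U], to which the point at infinity
belongs. Hence the superlevel set [1/2 <= g] is compact in [T], and cutting [g]
at this level yields a compact support. *)
Lemma exists_bump (C U : set T) : compact C -> open U -> C `<=` U ->
  exists b : T -> R, [/\ continuous b, forall s, 0 <= b s <= 1,
    forall s, C s -> b s = 1, forall s, b s != 0 -> U s &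
    compact (closure [set s | b s != 0])].
Proof.
move=> cC oU CU; pose X := one_point_compactification T.
have HX : hausdorff_space X by exact: one_point_compactification_hausdorff.
have CX : compact [set: X] by exact: one_point_compactification_compact.
have normalX : normal_space X by exact: compact_normal.
have := (@normal_separatorP R X).1 normalX (~` (Some @` U)) (Some @` C).
case.
- by apply: open_closedC; exact: one_point_compactification_open_some.
- apply: compact_closed => //; apply: continuous_compact => //.
  apply: continuous_subspaceT.
  exact: one_point_compactification_some_continuous.
- by rewrite -subset0 => x [nU [s Cs sx]]; apply: nU; exists s => //; exact: CU.
move=> E sepE; have /(@uniform_separatorP _ R)[f [cf f01 f0 f1]] :
  uniform_separator (~` (Some @` U) : set X) (Some @` C) by exists E.
pose g (s : T) := f (Some s).
have cg : continuous g.
  move=> s; apply: (@continuous_comp T X R Some f s); last exact: cf.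
  exact: one_point_compactification_some_continuous.
have g01 s : 0 <= g s <= 1.
  by have /f01 : range f (g s) by [exists (Some s)]; rewrite /= in_itv.
pose b s := Num.max 0 (2 * g s - 1).
have bg s : b s != 0 -> 2^-1 <= g s.
  apply: contraR; rewrite -ltNge => gs; apply/eqP/max_idPl.
  by move: gs; have : 2 * 2^-1 = 1 :> R by [rewrite mulfV|]; lra.
exists b; split.
- move=> s; apply: (@continuous_max _ T (fun=> 0) (fun s => 2 * g s - 1)).
    exact: cvg_cst.
  apply: cvgB; last exact: cvg_cst.
  by apply: cvgM; [exact: cvg_cst|exact: cg].
- move=> s; have := g01 s; rewrite /b le_max lexx ge_max ler01 /=; lra.
- move=> s Cs; rewrite /b /g; have -> : f (Some s) = 1.
    by apply: f1; exists (Some s) => //; exists s.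
  by rewrite mulr1 (_ : 2 - 1 = 1) ?max_r//; lra.
- move=> s /bg gs; apply: contrapT => nU.
  have fs0 : f (Some s) = 0.
    by apply: f0; exists (Some s) => // -[t Ut ts]; apply: nU; case: ts => <-.
  by move: gs; rewrite /g fs0 leNgt invr_gt0 ltr0n.
- have fN : f None = 0 by apply: f0; exists None => // -[].
  have : nbhs (None : X) [set x | f x < 2^-1].
    apply: (cf None [set x | x < 2^-1]).
    apply: open_nbhs_nbhs; split; first exact: open_lt.
    by rewrite /= fN invr_gt0.
  move=> [K [cK _] KU].
  have sub : [set s | 2^-1 <= g s] `<=` K.
    move=> s /= gs; apply: contrapT => nK.
    have : f (Some s) < 2^-1 by apply: KU; left; exists s.
    by rewrite ltNge gs.
  apply: (subclosed_compact _ cK); first exact: closed_closure.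
  have closed_g : closed [set s | 2^-1 <= g s].
    exact: (@closed_comp _ _ g [set x | 2^-1 <= x] (fun s _ => cg s)
      (@closed_ge _ _)).
  apply: subset_trans sub; rewrite [X in _ `<=` X]((closure_id _).1 closed_g).
  by apply: closureS => s /bg.
Qed.

End bump.

(** * Tight families of coefficients *)

Lemma eq0_outside_support (T : topologicalType) (V : nmodType) (a : T -> V) s :
  ~ closure [set t | a t != 0] s -> a s = 0.
Proof. by apply: contra_notP => /eqP as0; exact: subset_closure. Qed.

Lemma rnorm_continuous (R : realType) (T : topologicalType)
    (V : normedModType R[i]) (f : T -> V) :
  continuous f -> continuous (fun s => rnorm (f s)).
Proof.
move=> cf s; apply/cvgrPdist_le => e e0.
have /cvg_rnormP/(_ e e0) := cf s; apply: filterS => t fts.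
have := rnormD (f t - f s) (f s); have := rnormD (f s - f t) (f t).
rewrite !subrK (rnormBC (f s)) ler_norml; lra.
Qed.

Lemma compact_ubound (R : realType) (T : topologicalType) (C : set T)
    (h : T -> R) : compact C -> continuous h ->
  exists2 M, 0 <= M & forall s, C s -> h s <= M.
Proof.
move=> /compact_near_coveringP cC ch.
have /cC : forall s, C s -> \forall s' \near s & M \near +oo, h s' <= M.
  move=> s _; exists ([set t | `|h s - h t| <= 1], [set M | h s + 1 <= M]).
    split => /=; last exact: nbhs_pinfty_ge (num_real _).
    by have /cvgrPdist_le/(_ 1 ltr01) := ch s.
  move=> [t M] [/= ht hM]; move: ht; rewrite ler_norml; lra.
move=> hM; have ge0 := nbhs_pinfty_ge (num_real (0 : R)).
by have [M [M0 CM]] := filter_ex (filterI ge0 hM); exists M.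
Qed.

Lemma compact_net (R : realType) (T : ptopologicalType) (V : normedModType R[i])
    (C : set T) (g : T -> V) (d : R) : compact C -> continuous g -> 0 < d ->
  exists s : seq V, forall t, C t -> exists2 v, v \in s & rnorm (g t - v) <= d.
Proof.
rewrite compact_cover => cC cg d0.
have near_g i : nbhs i [set t | rnorm (g t - g i) <= d].
  by have /cvg_rnormP/(_ d d0) := cg i.
have [||D _ CD] := cC T C (fun i => ([set t | rnorm (g t - g i) <= d])°).
- by move=> i _; exact: open_interior.
- by move=> i Ci; exists i => //; exact: near_g.
exists [seq g i | i <- finmap.enum_fset D] => t /CD[i /= iD /interior_subset gti].
by exists (g i) => //; exact: map_f.
Qed.

Lemma nneg_sup_cvg0P (R : realType) (T : topologicalType) (I : Type)
    (A : set I) (f : T -> I -> R) (s0 : T) :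
  nneg_sup [set (f s i)%:E | i in A] @[s --> s0] --> 0%E <->
  forall e, 0 < e -> \forall s \near s0, forall i, A i -> f s i <= e.
Proof.
split=> [cv e e0|cv].
  have : \forall s \near s0, (nneg_sup [set (f s i)%:E | i in A] < e%:E)%E.
    apply: (cv [set x | (x < e%:E)%E]); apply: open_nbhs_nbhs; split.
      exact: open_ereal_lt_ereal.
    by rewrite /= lte_fin.
  apply: filterS => s /ltW sup_e i Ai; rewrite -lee_fin (le_trans _ sup_e)//.
  by apply: ereal_sup_ubound; right; exists i.
move=> N /= [e /= e0 Ne].
have := cv (e / 2) (divr_gt0 e0 (ltr0Sn R 1)); apply: filterS => s fs /=.
have : (0 <= nneg_sup [set (f s i)%:E | i in A])%E.
  by apply: ereal_sup_ubound; left.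
have : (nneg_sup [set (f s i)%:E | i in A] <= (e / 2)%:E)%E.
  apply: ge_ereal_sup => _ [->|[i Ai <-]]; rewrite lee_fin ?fs//.
  by rewrite divr_ge0 ?(ltW e0).
case: (nneg_sup _) => [r||]//; rewrite !lee_fin => re r0; apply: Ne.
rewrite /= sub0r normrN ger0_norm// (le_lt_trans re)//.
by rewrite ltr_pdivrMr// ltr_pMr// ltr1n.
Qed.

Lemma le_sum_mem (R : realDomainType) (I : eqType) (s : seq I) (F : I -> R) i :
  (forall j, 0 <= F j) -> i \in s -> F i <= \sum_(j <- s) F j.
Proof. by move=> F0 si; rewrite (big_rem i)//= lerDl sumr_ge0. Qed.

Section orbit_map.
Variables (R : realType) (H : hilbertType R) (T : ptopologicalType).
Variable mu : {measure set (borel T) -> \bar R}.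
Variable pi : T -> bounded_op H.
Hypothesis mu_radon : radon mu.
Hypothesis pi_square_integrable : forall u v : H,
  (\int[mu]_s (rnorm (hdot (pi s u) v) ^+ 2)%:E =
   (rnorm u ^+ 2 * rnorm v ^+ 2)%:E)%E.
Hypothesis pi_adjoint_continuous : forall u : H,
  continuous (fun s => adjoint (pi s) u).

Lemma phiE w u s : phi pi w u s = hdot u (adjoint (pi s) w).
Proof. exact: adjointE. Qed.

Lemma phiB w u v s : phi pi w (u - v) s = phi pi w u s - phi pi w v s.
Proof. by rewrite !phiE hdotBl. Qed.

Lemma l2sqr_phi w u : l2sqr mu (phi pi w u) = (rnorm u ^+ 2 * rnorm w ^+ 2)%:E.
Proof. exact: pi_square_integrable. Qed.

(** The continuity of the coefficients, and with it their measurability, comes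
from the strong continuity of [s |-> adjoint (pi s)]. *)
Lemma phi_continuous w u : continuous (phi pi w u : T -> R[i]^o).
Proof.
move=> s; apply/cvg_rnormP => e e0.
have e1 : 0 < e / (rnorm u + 1) by rewrite divr_gt0// ltr_wpDl ?rnorm_ge0.
have /cvg_rnormP/(_ _ e1) := @pi_adjoint_continuous w s.
apply: filterS => t gts; rewrite !phiE -hdotBr (le_trans (rnorm_hdot _ _))//.
rewrite (le_trans (ler_wpM2l (rnorm_ge0 _) gts))// mulrA.
rewrite ler_pdivrMr ?ltr_wpDl ?rnorm_ge0//.
by rewrite mulrDr mulr1 mulrC lerDl ltW.
Qed.

Lemma sqr_rnorm_borel (V : normedModType R[i]) (f : T -> V) : continuous f ->
  measurable_fun [set: borel T] (fun s : borel T => rnorm (f s) ^+ 2).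
Proof.
move=> cf; apply: measurable_funX; apply: continuous_borel.
exact: rnorm_continuous.
Qed.

Lemma sqr_rnormM_borel (a b : T -> R[i]) :
  continuous (a : T -> R[i]^o) -> continuous (b : T -> R[i]^o) ->
  measurable_fun [set: borel T] (fun s : borel T => rnorm (a s * b s) ^+ 2).
Proof.
move=> ca cb.
rewrite (_ : (fun s => _) = (fun s => rnorm (a s) ^+ 2 * rnorm (b s) ^+ 2)).
  by apply: measurable_funM;
    [exact: (@sqr_rnorm_borel R[i]^o)|exact: (@sqr_rnorm_borel R[i]^o)].
by apply/funext => s; rewrite rnormM exprMn.
Qed.

Variables (Omega : set H) (B : R).
Hypothesis OmegaB : forall u, Omega u -> rnorm u <= B.

(** As [u |-> phi pi w u] is [rnorm w] times an isometry into L^2, it suffices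
to bound the L^2 norm of [phi pi w (u - v)]. Outside the multiplier [a] it is
small by tightness; on the support of [a], which has finite measure, it is the
scalar product of [u - v] with [adjoint (pi s) w]. *)
Lemma tight_phi_control w (a : T -> R[i]) (e A m S : R) u v :
  continuous (a : T -> R[i]^o) -> 0 <= e -> 0 <= m -> 0 <= S ->
  mu (closure [set s | a s != 0]) = m%:E ->
  (forall s, rnorm (a s) <= A) ->
  (forall s, closure [set s | a s != 0] s ->
     rnorm (hdot (u - v) (adjoint (pi s) w)) <= S) ->
  (l2norm mu (fun s => a s * phi pi w u s - phi pi w u s)%R <= e%:E)%E ->
  (l2norm mu (fun s => a s * phi pi w v s - phi pi w v s)%R <= e%:E)%E ->
  rnorm w * rnorm (u - v) <= 2 * A * (m + 1) * S + 3 * e.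
Proof.
move=> ca e0 m0 S0 muC aA gS ue ve.
have A0 : 0 <= A by rewrite (le_trans _ (aA point)) ?rnorm_ge0.
rewrite l2norm_le// in ue; rewrite l2norm_le// in ve.
pose C := closure [set s | a s != 0].
have mC : measurable (C : set (borel T)).
  by apply: closed_borel; exact: closed_closure.
have ca1 : continuous ((fun s => a s - 1) : T -> R[i]^o).
  by move=> s; apply: cvgB; [exact: ca|exact: cvg_cst].
have E x s : a s * phi pi w x s - phi pi w x s = (a s - 1) * phi pi w x s.
  by rewrite mulrBl mul1r.
have mE x : measurable_fun [set: borel T] (fun s : borel T =>
    rnorm (a s * phi pi w x s - phi pi w x s) ^+ 2).
  rewrite (_ : (fun s => _) = (fun s => rnorm ((a s - 1) * phi pi w x s) ^+ 2)).
    exact: sqr_rnormM_borel ca1 (@phi_continuous w x).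
  by apply/funext => s; rewrite E.
have mP x : measurable_fun [set: borel T] (fun s : borel T =>
    rnorm (a s * phi pi w x s) ^+ 2).
  exact: sqr_rnormM_borel ca (@phi_continuous w x).
have mphi x : measurable_fun [set: borel T] (fun s : borel T =>
    rnorm (phi pi w x s) ^+ 2).
  exact: (@sqr_rnorm_borel R[i]^o _ (@phi_continuous w x)).
have sq0 (z : T -> R[i]) s : 0 <= rnorm (z s) ^+ 2 by rewrite sqr_ge0.
have tail_le : (l2sqr mu (fun s => a s * phi pi w (u - v) s - phi pi w (u - v) s)%R
    <= (4 * e ^+ 2)%:E)%E.
  apply: (@le_trans _ _ (2%:E * l2sqr mu (fun s => a s * phi pi w u s - phi pi w u s)%R
     + 2%:E * l2sqr mu (fun s => a s * phi pi w v s - phi pi w v s)%R)%E).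
    apply: le_integral_lin => //; do ?exact: sq0.
    move=> s _; rewrite phiB; set x := phi pi w u s; set y := phi pi w v s.
    rewrite (_ : _ - _ = (a s * x - x) + - (a s * y - y)); last by ring.
    by rewrite (le_trans (sqr_rnormD_le _ _))// rnormN.
  rewrite (_ : (4 * e ^+ 2)%:E = 2%:E * (e ^+ 2)%:E + 2%:E * (e ^+ 2)%:E)%E.
    by apply: leeD; apply: lee_wpmul2l.
  by rewrite -!EFinM -EFinD; congr EFin; ring.
have core_le : (l2sqr mu (fun s => (a s * phi pi w (u - v) s)%R) <=
    ((A * S) ^+ 2)%:E * m%:E)%E.
  rewrite -muC; apply: integral_bounded_support => //; do ?exact: sq0.
  - exact: sqr_ge0.
  - move=> s Cs; rewrite ler_sqr ?nnegrE ?rnorm_ge0 ?mulr_ge0//.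
    by rewrite rnormM phiE ler_pM ?rnorm_ge0 ?gS.
  - by move=> s /eq0_outside_support ->; rewrite mul0r rnorm0 expr0n.
have : (l2sqr mu (phi pi w (u - v)%R) <=
    2%:E * (((A * S) ^+ 2)%:E * m%:E) + 2%:E * (4 * e ^+ 2)%:E)%E.
  apply: (@le_trans _ _ (2%:E * l2sqr mu (fun s => (a s * phi pi w (u - v) s)%R)
     + 2%:E * l2sqr mu (fun s => a s * phi pi w (u - v) s - phi pi w (u - v) s)%R)%E).
    apply: le_integral_lin => //; do ?exact: sq0.
    move=> s _; set x := phi pi w _ s; set y := a s * x.
    have -> : rnorm x = rnorm (y + - (y - x)) by rewrite opprB addrC subrK.
    by rewrite (le_trans (sqr_rnormD_le _ _))// rnormN.
  by apply: leeD; apply: lee_wpmul2l.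
rewrite l2sqr_phi -!EFinM -EFinD lee_fin => main.
apply: ler_sqrD_le; rewrite ?mulr_ge0 ?addr_ge0//.
rewrite exprMn mulrC (le_trans main)// lerD//; last first.
  by have := sqr_ge0 e; rewrite exprMn; lra.
rewrite (_ : (2 * A * (m + 1) * S) ^+ 2 = 4 * (A * S) ^+ 2 * (m + 1) ^+ 2); last by ring.
rewrite mulrA ler_pM ?mulr_ge0 ?sqr_ge0 ?ler_wpM2r ?sqr_ge0 ?ler_nat//.
by rewrite expr2 mulrDl mulrDr; have := mulr_ge0 m0 m0; lra.
Qed.

(** On the compact support of [a] the vectors [adjoint (pi s) w] form a compact
set; its finite nets provide the finitely many scalar products required by the
compactness criterion. *)
Lemma relatively_compact_of_tight_phi w : w != 0 ->
  tight_L2 mu (@Cc R T) [set phi pi w u | u in Omega] -> compact (closure Omega).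
Proof.
move=> w0 tight; apply: relatively_compact_of_weak_control OmegaB _ => e e0.
have nw : 0 < rnorm w by rewrite rnorm_gt0.
(* The tightness error contributes at most [3 * d / rnorm w] to [rnorm (u - v)],
and the net error at most [e / 4]. *)
pose d := e * rnorm w / 8.
have d0 : 0 < d by rewrite divr_gt0// mulr_gt0.
have [a [ca cC] sup_a] := tight d d0.
have tail u : Omega u ->
    (l2norm mu (fun s => a s * phi pi w u s - phi pi w u s)%R <= d%:E)%E.
  move=> Ou; apply: le_trans sup_a; apply: ereal_sup_ubound.
  by exists (phi pi w u) => //; exists u.
set C := closure _ in cC.
have [A A0 aA] : exists2 A, 0 <= A & forall s, rnorm (a s) <= A.
  have [A A0 CA] := compact_ubound cC (@rnorm_continuous R T R[i]^o a ca).
  exists A => // s; have [->|as0] := eqVneq (a s) 0; first by rewrite rnorm0.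
  by apply: CA; exact: subset_closure.
have [mC _ _] := mu_radon.
have [m m0 muC] : exists2 m, 0 <= m & mu C = m%:E.
  have := mC _ cC; have : (0 <= mu C)%E by exact: measure_ge0.
  by case: (mu C) => [m||]//; rewrite lee_fin => m0; exists m.
pose c := 2 * A * (m + 1) / rnorm w.
have c0 : 0 <= c by rewrite divr_ge0 ?(ltW nw)// !mulr_ge0// addr_ge0.
pose r := e / (8 * (c * `|B| + 1)).
have r0 : 0 < r by rewrite divr_gt0// mulr_gt0// ltr_wpDl// mulr_ge0.
have [s sC] := compact_net cC (@pi_adjoint_continuous w) r0.
exists s, c => // u v Ou Ov.
set S := \sum_(_ <- s) _.
have S0 : 0 <= S by apply: sumr_ge0 => *; exact: rnorm_ge0.
have gS t : C t -> rnorm (hdot (u - v) (adjoint (pi t) w)) <= S + 2 * `|B| * r.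
  move=> /sC[x xs gx].
  rewrite -[adjoint _ _](subrK x) hdotDr addrC (le_trans (rnormD _ _))// lerD//.
    by apply: (@le_sum_mem _ _ s (fun x => rnorm (hdot (u - v) x))) => // *;
      exact: rnorm_ge0.
  rewrite (le_trans (rnorm_hdot _ _))// ler_pM ?rnorm_ge0//.
  rewrite (le_trans (rnormB _ _))//; have := OmegaB Ou; have := OmegaB Ov.
  have := ler_norm B; lra.
have SB0 : 0 <= S + 2 * `|B| * r.
  by apply: addr_ge0 => //; apply: mulr_ge0; [exact: mulr_ge0|exact: ltW].
have := tight_phi_control ca (ltW d0) m0 SB0 muC aA gS (tail u Ou) (tail v Ov).
have -> : 2 * A * (m + 1) = c * rnorm w by rewrite divfK ?gt_eqF.
have cr : c * (2 * `|B| * r) <= e / 4.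
  have cB : 0 < c * `|B| + 1 by rewrite ltr_wpDl// mulr_ge0.
  rewrite (_ : c * _ = e / 4 * (c * `|B| / (c * `|B| + 1))).
    rewrite ler_piMr ?divr_ge0 ?(ltW e0)// ler_pdivrMr// mul1r lerDl//.
  by rewrite /r; field; rewrite gt_eqF.
rewrite (_ : _ + 3 * d = rnorm w * (c * (S + 2 * `|B| * r) + 3 * e / 8)); last first.
  by rewrite /d; field.
rewrite ler_pM2l// mulrDr; lra.
Qed.

End orbit_map.

(** * Consequences of relative compactness *)

Lemma real_complex_continuous (R : realType) (T : topologicalType) (b : T -> R) :
  continuous b -> continuous ((fun s => (b s)%:C%C) : T -> R[i]^o).
Proof.
move=> cb s; apply/cvg_rnormP => e e0.
have /cvgrPdist_le/(_ e e0) := cb s; apply: filterS => t bt.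
by rewrite -rmorphB/= (rnorm_real (b t - b s)) distrC.
Qed.

Lemma real_Cc (R : realType) (T : topologicalType) (b : T -> R) :
  continuous b -> compact (closure [set s | b s != 0]) ->
  Cc (fun s => (b s)%:C%C).
Proof.
move=> cb cC; split; first exact: real_complex_continuous.
rewrite (_ : [set s | _] = [set s | b s != 0])//; apply/seteqP.
have E s : ((b s)%:C%C == 0 :> R[i]) = (b s == 0).
  by rewrite -(inj_eq (@complexI R)).
by split=> s /=; rewrite E.
Qed.

Section compact_consequences.
Variables (R : realType) (H : hilbertType R) (T : ptopologicalType).
Variable mu : {measure set (borel T) -> \bar R}.
Variable pi : T -> bounded_op H.
Hypotheses (T_hausdorff : hausdorff_space T)
  (T_lc : locally_compact [set: T]) (T_sigma : sigma_compact T).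
Hypothesis pi_square_integrable : forall u v : H,
  (\int[mu]_s (rnorm (hdot (pi s u) v) ^+ 2)%:E =
   (rnorm u ^+ 2 * rnorm v ^+ 2)%:E)%E.
Hypothesis pi_adjoint_continuous : forall u : H,
  continuous (fun s => adjoint (pi s) u).
Variable Omega : set H.
Hypothesis Omega_compact : compact (closure Omega).

Lemma sigma_compact_exhaustion : exists F : nat -> set T,
  [/\ forall n, compact (F n), nondecreasing_seq F & \bigcup_n F n = [set: T]].
Proof.
have [F cF FT] := T_sigma; exists (fun n => \big[setU/set0]_(i < n.+1) F i); split.
- by move=> n; exact: bigsetU_compact.
- move=> n m nm; rewrite subsetEset => s; rewrite -!bigcup_mkord => -[i /= ni Fis].
  by exists i => //=; exact: leq_trans ni _.
- apply/seteqP; split=> // s _; have [n _ Fns] : (\bigcup_n F n) s by rewrite FT.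
  by exists n => //; rewrite -bigcup_mkord; exists n => /=.
Qed.

(** For a single [u] the L^2 mass of [phi pi w u] outside [F n] tends to 0; since
this mass depends continuously on [u], compactness gives an [n] that serves all
of [Omega], and the multiplier is a bump equal to 1 on [F n]. *)
Lemma tight_phi_of_relatively_compact w :
  tight_L2 mu (@Cc R T) [set phi pi w u | u in Omega].
Proof.
move=> e e0; have [F [cF ndF FT]] := sigma_compact_exhaustion.
have mF n : measurable (F n : set (borel T)).
  by apply: closed_borel; exact: compact_closed.
have mphi x : measurable_fun [set: borel T] (fun s : borel T =>
    rnorm (phi pi w x s) ^+ 2).
  exact: (@sqr_rnorm_borel R T R[i]^o _
    (@phi_continuous R H T pi pi_adjoint_continuous w x)).
have mnF n : measurable (~` F n : set (borel T)) by apply: measurableC.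
pose r := e / (2 * (rnorm w + 1)).
have w1 : 0 < rnorm w + 1 by rewrite ltr_wpDl ?rnorm_ge0.
have r0 : 0 < r by rewrite divr_gt0// mulr_gt0.
have rw : 2 * (r ^+ 2 * rnorm w ^+ 2) <= e ^+ 2 / 2.
  rewrite (_ : 2 * _ = e ^+ 2 / 2 * (rnorm w / (rnorm w + 1)) ^+ 2).
    rewrite ler_piMr ?divr_ge0 ?sqr_ge0// expr_le1// ?divr_ge0 ?rnorm_ge0 ?ltW//.
    by rewrite ltr_pdivrMr// mul1r ltrDl.
  by rewrite /r; field; rewrite gt_eqF.
have e20 : 0 < e ^+ 2 / 4 by rewrite divr_gt0// exprn_gt0.
have /compact_near_coveringP cK := Omega_compact.
have /cK : forall u, closure Omega u -> \forall u' \near u & n \near \oo,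
    (\int[mu]_(s in ~` F n) (rnorm (phi pi w u' s) ^+ 2)%:E <= (e ^+ 2)%:E)%E.
  move=> u _.
  have tail := exhaustion_integral_tail mF ndF FT (mphi u)
    (fun s => sqr_ge0 _) (pi_square_integrable u w) e20.
  exists ([set u' | rnorm (u' - u) <= r],
    [set n | (\int[mu]_(s in ~` F n) (rnorm (phi pi w u s) ^+ 2)%:E <=
              (e ^+ 2 / 4)%:E)%E]).
    by split => //=; exact: near_rnorm.
  move=> [u' n] [/= uu' tail_n].
  apply: (@le_trans _ _
    (2%:E * \int[mu]_(s in ~` F n) (rnorm (phi pi w u s) ^+ 2)%:E +
     2%:E * \int[mu]_(s in ~` F n) (rnorm (phi pi w (u' - u)%R s) ^+ 2)%:E)%E).
    apply: le_integral_lin => //; do ?by move=> s; exact: sqr_ge0.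
    move=> s _; rewrite (_ : phi pi w u' s = phi pi w u s + phi pi w (u' - u) s).
      exact: sqr_rnormD_le.
    by rewrite phiB addrC subrK.
  rewrite (_ : (e ^+ 2)%:E = 2%:E * (e ^+ 2 / 4)%:E + (e ^+ 2 / 2)%:E)%E; last first.
    by rewrite -EFinM -EFinD; congr EFin; field.
  apply: leeD; first exact: lee_wpmul2l.
  apply: (@le_trans _ _ (2%:E * l2sqr mu (phi pi w (u' - u)%R))%E).
    apply: lee_wpmul2l => //; apply: ge0_subset_integral => //.
    - by apply/measurable_EFinP; exact: mphi.
    - by move=> s _; rewrite lee_fin sqr_ge0.
  rewrite (l2sqr_phi pi_square_integrable) -EFinM lee_fin (le_trans _ rw)//.
  by rewrite ler_pM2l// ler_wpM2r ?sqr_ge0// ler_sqr ?nnegrE ?rnorm_ge0 ?(ltW r0).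
move=> /filter_ex[n tail_n].
have [b [cb b01 b1 _ suppb]] := @exists_bump R T T_hausdorff T_lc (F n) setT
  (cF n) openT (@subsetT _ _).
have ca := real_Cc cb suppb.
exists (fun s => (b s)%:C%C) => //.
apply: ge_ereal_sup => _ [_ [u Ou <-] <-].
rewrite l2norm_le ?(ltW e0)//.
apply: le_trans (tail_n u (subset_closure Ou)).
have E s : rnorm ((b s)%:C%C * phi pi w u s - phi pi w u s) =
    `|b s - 1| * rnorm (phi pi w u s).
  rewrite -[X in _ - X]mul1r -mulrBl rnormM.
  by rewrite -(rmorph1 (real_complex R)) -rmorphB rnorm_real.
rewrite /l2sqr (@integral_support _ _ mu (~` F n)); last first.
  by move=> s /contrapT Fs; rewrite E b1// subrr normr0 mul0r expr0n.
apply: ge0_le_integral => //.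
- by move=> s _; rewrite lee_fin sqr_ge0.
- apply/measurable_EFinP; apply: measurable_funTS.
  rewrite (_ : (fun s => _) =
      (fun s => (b s - 1) ^+ 2 * rnorm (phi pi w u s) ^+ 2)).
    apply: measurable_funM => //; apply: measurable_funX; apply: continuous_borel.
    by move=> s; apply: cvgB; [exact: cb|exact: cvg_cst].
  by apply/funext => s; rewrite E exprMn real_normK ?num_real.
- by apply/measurable_EFinP; apply: measurable_funTS.
- move=> s _; rewrite lee_fin E ler_sqr ?nnegrE ?mulr_ge0 ?rnorm_ge0//.
  by rewrite ler_piMl ?rnorm_ge0// ler_norml; have := b01 s; lra.
Qed.

(** Uniform boundedness over a compact neighbourhood of [s0]. *)
Lemma adjoint_locally_bounded (s0 : T) : exists2 M, 0 <= M &
  \forall s \near s0, forall u, rnorm (adjoint (pi s) u) <= M * rnorm u.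
Proof.
have [U] := @T_lc s0 I; rewrite withinET => Us0 [cU _].
have [|||M M0 UM] := @uniform_boundedness R H T U (fun s => adjoint (pi s)).
- by move=> s a u v; exact: adjoint_linear.
- by move=> s; exact: adjoint_bounded.
- move=> u.
  have [M _ UM] := compact_ubound cU (rnorm_continuous (@pi_adjoint_continuous u)).
  by exists M.
by exists M => //; apply: filterS Us0 => s /UM.
Qed.

(** Strong continuity is uniform over compact sets of vectors, because the
operators [adjoint (pi s)] are bounded uniformly for [s] near [s0]. *)
Lemma adjoint_equicontinuous (s0 : T) (e : R) : 0 < e ->
  \forall s \near s0, forall u, Omega u ->
    rnorm (adjoint (pi s) u - adjoint (pi s0) u) <= e.
Proof.
move=> e0; have [M M0 near_M] := adjoint_locally_bounded s0.
pose r := e / (4 * (M + 1)).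
have M1 : 0 < M + 1 by rewrite ltr_wpDl.
have r0 : 0 < r by rewrite divr_gt0// mulr_gt0.
have Mr : M * r <= e / 4.
  rewrite (_ : M * r = e / 4 * (M / (M + 1))); last first.
    by rewrite /r; field; rewrite gt_eqF.
  by rewrite ler_piMr ?divr_ge0 ?(ltW e0)// ler_pdivrMr// mul1r lerDl.
have /compact_near_coveringP cK := Omega_compact.
pose P s u := rnorm (adjoint (pi s) u - adjoint (pi s0) u) <= e.
have /(cK _ (nbhs s0) P) : forall u, closure Omega u ->
    \forall u' \near u & s \near s0, P s u'.
  move=> u _; have e20 : 0 < e / 2 by rewrite divr_gt0.
  have /cvg_rnormP/(_ _ e20) near_s := @pi_adjoint_continuous u s0.
  exists ([set u' | rnorm (u' - u) <= r],
     [set s | rnorm (adjoint (pi s) u - adjoint (pi s0) u) <= e / 2] `&`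
     [set s | forall u, rnorm (adjoint (pi s) u) <= M * rnorm u]).
    by split => /=; [exact: near_rnorm|exact: filterI].
  move=> [u' s] [/= uu' [gs sM]].
  have s0M := nbhs_singleton near_M.
  have Mr' : M * rnorm (u' - u) <= e / 4 by rewrite (le_trans _ Mr)// ler_wpM2l.
  rewrite /P; have := sM (u' - u); have := s0M (u' - u); rewrite !adjointB.
  have := rnorm_triangle (adjoint (pi s) u) (adjoint (pi s) u') (adjoint (pi s0) u').
  have := rnorm_triangle (adjoint (pi s0) u) (adjoint (pi s) u) (adjoint (pi s0) u').
  rewrite (rnormBC (adjoint (pi s0) u)); lra.
by apply: filterS => s gs u Ou; apply: gs; exact: subset_closure.
Qed.

End compact_consequences.

(** * Symbolic calculus *)

Section tensor_operators.
Variables (R : realType) (H K : hilbertType R).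
Variables (tens : {bilinear H -> conj_hilbert H -> K}) (Lam : K -> bounded_op H).
Hypotheses (K_tensor : hilbert_tensor tens) (Lam_unitary : hs_unitary Lam).
Hypothesis Lam_tens : forall u v x : H, Lam (tens u v) x = hdot x v *: u.

Let Lam_linear a k l x : Lam (a *: k + l) x = a *: Lam k x + Lam l x.
Proof. by have [] := Lam_unitary. Qed.

Lemma LamB k l x : Lam (k - l) x = Lam k x - Lam l x.
Proof. by rewrite addrC -scaleN1r Lam_linear scaleN1r addrC. Qed.

Lemma LamD k l x : Lam (k + l) x = Lam k x + Lam l x.
Proof. by rewrite -[k]scale1r Lam_linear !scale1r. Qed.

Lemma Lam0 x : Lam 0 x = 0.
Proof. by rewrite -[X in Lam X](subrr 0) LamB subrr. Qed.

(** A unit vector is an orthonormal family with one member, so the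
Hilbert-Schmidt norm dominates the operator norm. *)
Lemma rnorm_Lam k x : rnorm (Lam k x) <= rnorm k * rnorm x.
Proof.
have [->|x0] := eqVneq x 0; first by rewrite linear0 !rnorm0 mulr0.
have nx : 0 < rnorm x by rewrite rnorm_gt0.
pose e := (rnorm x)^-1%:C%C *: x.
have ee : hdot e e = 1.
  rewrite hdotZl hdotZr conjC_real_complex -rnorm_sqr -!rmorphM/=.
  rewrite -(rmorph1 (real_complex R)).
  by congr (_%:C%C); field; rewrite gt_eqF.
have : ((rnorm (Lam k e) ^+ 2)%:E <= (rnorm k ^+ 2)%:E)%E.
  have [_ <- _] := Lam_unitary; apply: ereal_sup_ubound.
  by exists [:: e]; rewrite /= ?big_seq1// /orthonormal /= ee eqxx.
rewrite lee_fin ler_sqr ?nnegrE ?rnorm_ge0// linearZ/= rnormZ rnorm_real.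
by rewrite ger0_norm ?invr_ge0 ?rnorm_ge0// ler_pdivrMl// mulrC.
Qed.

Lemma tensor_sum_approx k (e : R) : 0 < e ->
  exists n (u : 'I_n -> H) (v : 'I_n -> H),
    rnorm (k - \sum_(i < n) tens (u i) (v i)) <= e.
Proof.
move=> e0; have [_ dense_sums] := K_tensor.
have [|y [By [n [u [v yE]]]]] :=
    dense_sums ([set y | rnorm (y - k) <= e])° _ (@open_interior _ _).
  by exists k; exact: near_rnorm.
by exists n, u, v; rewrite rnormBC -yE; exact: interior_subset By.
Qed.

Lemma Lam_sum n (u v : 'I_n -> H) x :
  Lam (\sum_(i < n) tens (u i) (v i)) x = \sum_(i < n) hdot x (v i) *: u i.
Proof.
rewrite (big_morph (fun k => Lam k x) (fun k l => LamD k l x) (Lam0 x)).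
by apply: eq_bigr => i _; rewrite Lam_tens.
Qed.

Lemma hdot_sum (V : hilbertType R) (I : Type) (s : seq I) (F : I -> V) v :
  hdot (\sum_(i <- s) F i) v = \sum_(i <- s) hdot (F i) v.
Proof.
exact: (big_morph (fun x => hdot x v) (fun x y => hdotDl x y v) (hdot0l v)).
Qed.

(** Both sides are continuous and linear in [k], and they agree on simple
tensors; in other words [tens v u] represents [<Lam _ u, v>] in [K]. *)
Lemma hdot_Lam k u v : hdot (Lam k u) v = hdot k (tens v u).
Proof.
apply/eqP; rewrite -subr_eq0 -(@rnorm_eq0 R R[i]) eq_le rnorm_ge0 andbT.
apply: (@ler_addeps _ _ _ (rnorm u * rnorm v + rnorm (tens v u))) => [|e e0].
  by rewrite addr_ge0 ?mulr_ge0 ?rnorm_ge0.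
have [n [a [b kE]]] := tensor_sum_approx k e0.
set k' := \sum_(i < n) _ in kE.
have E : hdot (Lam k' u) v = hdot k' (tens v u).
  rewrite Lam_sum !hdot_sum; apply: eq_bigr => i _.
  by have [tens_dot _] := K_tensor; rewrite tens_dot hdotZl mulrC.
rewrite add0r (_ : _ - _ = hdot (Lam (k - k') u) v - hdot (k - k') (tens v u)).
  rewrite (le_trans (rnormB _ _))// mulrDl; apply: lerD.
    rewrite (le_trans (rnorm_hdot _ _))// mulrAC ler_wpM2r ?rnorm_ge0//.
    by rewrite (le_trans (rnorm_Lam _ _))// mulrC ler_wpM2l ?rnorm_ge0.
  by rewrite (le_trans (rnorm_hdot _ _))// mulrC ler_wpM2l ?rnorm_ge0.
by rewrite LamB !hdotBl E opprB addrA subrK.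
Qed.

(** Operators in the range of [Lam] are Hilbert-Schmidt, hence limits in norm of
operators of finite rank, for which the compactness criterion is immediate. *)
Lemma relatively_compact_of_tight_operators (Omega : set H) (B : R)
    (A : set (bounded_op H)) :
  (forall u, Omega u -> rnorm u <= B) -> A `<=` range Lam ->
  tight_hilbert A Omega -> compact (closure Omega).
Proof.
move=> OmegaB ALam tight; apply: (relatively_compact_of_weak_control OmegaB) => e e0.
have e80 : 0 < e / 8 by rewrite divr_gt0.
have [S AS] := tight _ e80; have [k _ <-{S AS}] := ALam _ AS => sup_k.
have approx u : Omega u -> rnorm (Lam k u - u) <= e / 8.
  move=> Ou; rewrite -lee_fin; apply: le_trans sup_k; apply: ereal_sup_ubound.
  by exists u.
pose r := e / (8 * (`|B| + 1)).
have B1 : 0 < `|B| + 1 by rewrite ltr_wpDl.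
have r0 : 0 < r by rewrite divr_gt0// mulr_gt0.
have rB : r * `|B| <= e / 8.
  rewrite (_ : r * _ = e / 8 * (`|B| / (`|B| + 1))).
    by rewrite ler_piMr ?divr_ge0 ?(ltW e0)// ler_pdivrMr// mul1r lerDl.
  by rewrite /r; field; rewrite gt_eqF.
have [n [a [b kE]]] := tensor_sum_approx k r0.
set k' := \sum_(i < n) _ in kE.
pose c := \sum_(i < n) rnorm (a i).
have c0 : 0 <= c by apply: sumr_ge0 => *; exact: rnorm_ge0.
exists [seq b i | i <- index_enum 'I_n], c => // u v Ou Ov.
rewrite big_map.
have finite_rank : rnorm (Lam k' (u - v)) <=
    c * \sum_(i < n) rnorm (hdot (u - v) (b i)).
  rewrite Lam_sum (le_trans (rnorm_sum _ _))// mulr_sumr ler_sum// => i _.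
  rewrite rnormZ mulrC ler_wpM2r ?rnorm_ge0//.
  by apply: (@le_sum_mem _ _ _ (fun i => rnorm (a i))) => [j|];
    rewrite ?rnorm_ge0// mem_index_enum.
have remainder : rnorm (Lam (k - k') (u - v)) <= 2 * (r * `|B|).
  rewrite (le_trans (rnorm_Lam _ _))// mulrCA ler_pM ?rnorm_ge0//.
  rewrite (le_trans (rnormB _ _))//; have := OmegaB u Ou; have := OmegaB v Ov.
  have := ler_norm B; lra.
have := approx u Ou; have := approx v Ov.
have : rnorm (u - v) <= rnorm (Lam k u - u) + rnorm (Lam k v - v) +
    (rnorm (Lam (k - k') (u - v)) + rnorm (Lam k' (u - v))).
  have E : u - v = (- (Lam k u - u) + (Lam k v - v)) +
      (Lam (k - k') (u - v) + Lam k' (u - v)).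
    rewrite LamB subrK [Lam k (u - v)]linearB/=; move: (Lam k u) (Lam k v) => x y.
    rewrite -[LHS](subrKA x) -[X in _ + X = _](subrKA y) opprB -[RHS]addrA.
    by rewrite [b in _ + b = _]addrC.
  rewrite [X in rnorm X <= _]E (le_trans (rnormD _ _))// lerD ?rnormD//.
  by rewrite (le_trans (rnormD _ _))// rnormN.
move: finite_rank remainder rB.
set X := c * _; set Y := r * _; lra.
Qed.

End tensor_operators.

Section symbolic_calculus.
Variables (R : realType) (H : hilbertType R) (T : ptopologicalType).
Variable mu : {measure set (borel T) -> \bar R}.
Variable pi : T -> bounded_op H.
Variables (K : hilbertType R) (tens : {bilinear H -> conj_hilbert H -> K}).
Variables (Phi : K -> T -> R[i]) (Lam : K -> bounded_op H).
Hypotheses (T_hausdorff : hausdorff_space T)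
  (T_lc : locally_compact [set: T]) (mu_radon : radon mu).
Hypothesis pi_adjoint_continuous : forall u : H,
  continuous (fun s => adjoint (pi s) u).
Hypotheses (K_tensor : hilbert_tensor tens) (Phi_isometry : l2_isometry mu Phi).
Hypothesis Phi_tens : forall u v : H,
  \forall s \ae mu, Phi (tens u v) s = hdot (pi s u) v.
Hypotheses (Phi_surjective : l2_surjective mu Phi) (Lam_unitary : hs_unitary Lam).
Hypothesis Lam_tens : forall u v x : H, Lam (tens u v) x = hdot x v *: u.

Lemma square_integrable_borel f : square_integrable mu f ->
  measurable_fun [set: borel T] (fun s : borel T => rnorm (f s) ^+ 2).
Proof.
move=> [mRe mIm _].
rewrite (_ : (fun s => _) =
    (fun s => complex.Re (f s) ^+ 2 + complex.Im (f s) ^+ 2)).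
  by apply: measurable_funD; apply: measurable_funX.
by apply/funext => s; rewrite sqr_rnorm.
Qed.

Lemma l2sqr_Phi k : l2sqr mu (Phi k) = (rnorm k ^+ 2)%:E.
Proof. by apply: l2norm_eq; have [_ _] := Phi_isometry. Qed.

Lemma l2sqr_ae f g :
  measurable_fun [set: borel T] (fun s : borel T => rnorm (f s) ^+ 2) ->
  measurable_fun [set: borel T] (fun s : borel T => rnorm (g s) ^+ 2) ->
  f = g %[ae mu] -> l2sqr mu f = l2sqr mu g.
Proof.
move=> mf mg fg; apply: ge0_ae_eq_integral => //.
- by apply/measurable_EFinP.
- by apply/measurable_EFinP.
- by move=> s _; rewrite lee_fin sqr_ge0.
- by move=> s _; rewrite lee_fin sqr_ge0.
- by apply: filterS fg => s fgs _; rewrite fgs.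
Qed.

Lemma Phi_borel k :
  measurable_fun [set: borel T] (fun s : borel T => rnorm (Phi k s) ^+ 2).
Proof. by apply: square_integrable_borel; have [] := Phi_isometry. Qed.

Lemma Cc_square_integrable (b : T -> R) : continuous b ->
  (forall s, 0 <= b s <= 1) -> compact (closure [set s | b s != 0]) ->
  forall c, square_integrable mu (fun s => (c * b s)%:C%C).
Proof.
move=> cb b01 cC c; have mb := continuous_borel cb.
split.
- by apply: measurable_funM => //; exact: measurable_cst.
- exact: measurable_cst.
apply: l2norm_lty; have [muC _ _] := mu_radon.
set C := closure _ in cC.
have muC_fin : ((c ^+ 2)%:E * mu C < +oo)%E.
  have := muC _ cC; have : (0 <= mu C)%E by exact: measure_ge0.
  by case: (mu _) => [m||]// _ _; rewrite -EFinM ltry.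
apply: le_lt_trans muC_fin; apply: integral_bounded_support.
- by apply: closed_borel; exact: closed_closure.
- rewrite (_ : (fun s => _) = (fun s => c ^+ 2 * b s ^+ 2)).
    apply: measurable_funM; [exact: measurable_cst|exact: measurable_funX].
  by apply/funext => s; rewrite rnorm_real real_normK ?num_real// exprMn.
- by move=> s; exact: sqr_ge0.
- exact: sqr_ge0.
- move=> s _; rewrite rnorm_real real_normK ?num_real// exprMn ler_piMr ?sqr_ge0//.
  by have := b01 s; rewrite expr2 => /andP[b0 b1]; rewrite mulr_ile1.
- by move=> s /eq0_outside_support ->; rewrite mulr0 rnorm0 expr0n.
Qed.

(** Weakly, [Lam k] is the integral of [h s *: adjoint (pi s)], so that
[Re <Lam k u, v>] is an average, for the probability density [h], of
[Re <adjoint (pi s) u, v>]. By [hdot_Lam] and polarization, [4 Re <Lam k u, v>]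
is the difference of the squared L^2 norms of [f + p] and [f - p], where
[f = Phi k] and [p = Phi (tens v u)] almost everywhere; the pointwise identity
[|f + p|^2 - |f - p|^2 = 4 h Re p] then reduces the claim to an inequality
between integrals of nonnegative functions. *)
Lemma Re_symbol_le (k : K) (h : T -> R) (u v : H) (c : R) :
  continuous h -> (forall s, 0 <= h s) -> (\int[mu]_s (h s)%:E = 1)%E ->
  Phi k = (fun s => (h s)%:C%C) %[ae mu] ->
  (forall s, h s != 0 -> complex.Re (hdot (adjoint (pi s) u) v) <= c) ->
  complex.Re (hdot (Lam k u) v) <= c.
Proof.
move=> ch h0 int_h Phi_k hc; rewrite (hdot_Lam K_tensor Lam_unitary Lam_tens).
set t := tens v u; pose f s : R[i] := (h s)%:C%C; pose p := phi pi u v.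
have [_ Phi_lin _] := Phi_isometry.
have cf : continuous (f : T -> R[i]^o) by exact: real_complex_continuous.
have cp : continuous (p : T -> R[i]^o).
  exact: (@phi_continuous R H T pi pi_adjoint_continuous).
have mfp (eps : R[i]) : measurable_fun [set: borel T]
    (fun s : borel T => rnorm (f s + eps * p s) ^+ 2).
  apply: (@sqr_rnorm_borel R T R[i]^o) => s.
  by apply: cvgD; [exact: cf|apply: cvgM; [exact: cvg_cst|exact: cp]].
have norm_sq (eps : R[i]) :
    (\int[mu]_s (rnorm (f s + eps * p s) ^+ 2)%:E =
     (rnorm (eps *: t + k) ^+ 2)%:E)%E.
  rewrite -l2sqr_Phi; apply/esym/l2sqr_ae => //; first exact: Phi_borel.
  have ae_filter : Filter (nbhs (almost_everywhere mu)).
    exact: ae_filter_ringOfSetsType.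
  have := Phi_tens v u; have := Phi_lin eps t k; have := Phi_k.
  apply: (@filterS3 _ _ ae_filter) => s /(_ I) Pk Pl Pt _.
  by rewrite Pl Pt Pk addrC.
have mh := continuous_borel ch.
have c4 : 0 <= 4 * `|c| by rewrite mulr_ge0.
have cc0 : 0 <= 4 * (`|c| + c) by rewrite mulr_ge0// -lerBlDl sub0r lerNnormlW.
(* [c] may be negative: adding [4 * `|c| * h] on both sides keeps all the
integrands nonnegative. *)
have left_eq := @ge0_integral_lin R T mu setT
  (fun s => rnorm (f s + 1 * p s) ^+ 2) h 1 (4 * `|c|) measurableT (mfp 1) mh
  (fun s => sqr_ge0 _) h0 ler01 c4.
have : (\int[mu]_s (1 * rnorm (f s + 1 * p s) ^+ 2 + 4 * `|c| * h s)%:E <=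
   1%:E * \int[mu]_s (rnorm (f s + -1 * p s) ^+ 2)%:E +
   (4 * (`|c| + c))%:E * \int[mu]_s (h s)%:E)%E.
  apply: le_integral_lin => //.
  - apply: measurable_funD; apply: measurable_funM => //; exact: measurable_cst.
  - by move=> s; rewrite addr_ge0 ?(mulr_ge0 c4 (h0 s))// mul1r sqr_ge0.
  - by move=> s; exact: sqr_ge0.
  move=> s _.
  have : h s * complex.Re (p s) <= h s * c.
    have [->|hs] := eqVneq (h s) 0; first by rewrite !mul0r.
    by rewrite ler_wpM2l// (le_trans _ (hc s hs))// /p phiE Re_hdotC.
  rewrite !mul1r !mulN1r !sqr_rnorm /f; case: (p s) => x y /=; nra.
rewrite left_eq !norm_sq int_h !mule1 !mul1e -!EFinD lee_fin.
rewrite scale1r scaleN1r addrC [- t + k]addrC [t + k]addrC.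
rewrite sqr_rnormD sqr_rnormB; lra.
Qed.

Variable s1 : T.
Hypothesis pi_s1 : forall u, adjoint (pi s1) u = u.
Hypothesis s1_support : measure_support mu s1.

(** If [H] were zero then all operators on [H], and by [Lam_unitary] all of [K],
would vanish; but a bump at a point of the support of [mu] is a nonzero element
of L^2 in the range of [Phi]. *)
Lemma exists_nonzero : exists w : H, w != 0.
Proof.
have [b [cb b01 b1 _ cC]] := @exists_bump R T T_hausdorff T_lc [set s1] setT
  (@compact_set1 _ s1) openT (@subsetT _ _).
have si_b := Cc_square_integrable cb b01 cC 1.
have [k Phi_k] := Phi_surjective si_b.
apply: contrapT => H0.
have H_eq0 x : x = 0 :> H.
  by apply/eqP; apply: contrapT => /negP x0; apply: H0; exists x.
have : (0 < l2sqr mu (Phi k))%E.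
  rewrite (l2sqr_ae (Phi_borel k) (square_integrable_borel si_b) Phi_k).
  rewrite /l2sqr.
  under eq_integral do rewrite mul1r rnorm_real real_normK ?num_real//.
  apply: (@integral_gt0_support _ _ _ (fun s => b s ^+ 2) s1) => //.
  - move=> s; apply: (@continuous_comp T R R b (fun x => x ^+ 2)); first exact: cb.
    exact: exprn_continuous.
  - by move=> s; exact: sqr_ge0.
  - by rewrite b1// expr1n ltr01.
rewrite l2sqr_Phi; have [_ <- _] := Lam_unitary; rewrite ltNge => /negP; apply.
apply: ge_ereal_sup => _ [s _ <-]; rewrite lee_fin big1// => e _.
by rewrite (H_eq0 (Lam k e)) rnorm0 expr0n.
Qed.

(** For a symbol [h >= 0] of integral 1 supported close to [s1], the operator
[Pi h] averages operators [adjoint (pi s)] that are uniformly close on [Omega]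
to [adjoint (pi s1) = 1]. *)
Lemma tight_symbols_of_equicontinuous (Omega : set H) :
  (forall e : R, 0 < e -> \forall s \near s1, forall u, Omega u ->
     rnorm (adjoint (pi s) u - adjoint (pi s1) u) <= e) ->
  tight_hilbert [set symbolic_calculus mu Phi Lam f | f in @Cc R T] Omega.
Proof.
move=> equi e e0; pose U := [set s | forall u, Omega u ->
     rnorm (adjoint (pi s) u - adjoint (pi s1) u) <= e].
have [b [cb b01 b1 bU cC]] := @exists_bump R T T_hausdorff T_lc [set s1] U°
  (@compact_set1 _ s1) (@open_interior _ _) ltac:(by move=> _ ->; exact: equi).
have b0 s : 0 <= b s by case/andP: (b01 s).
have [c c0 int_b] : exists2 c, 0 < c & (\int[mu]_s (b s)%:E = c%:E)%E.
  have : (0 < \int[mu]_s (b s)%:E)%E.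
    by apply: integral_gt0_support s1_support _ => //; rewrite b1.
  set C := closure _ in cC.
  have : (\int[mu]_s (b s)%:E <= 1%:E * mu C)%E.
    apply: integral_bounded_support => //.
    - by apply: closed_borel; exact: closed_closure.
    - exact: continuous_borel.
    - by move=> s _; case/andP: (b01 s).
    - by move=> s /eq0_outside_support.
  have [muC _ _] := mu_radon; rewrite mul1e => /le_lt_trans/(_ (muC _ cC)).
  by case: (\int[mu]_s _)%E => [c||]//; rewrite lte_fin => _ c0; exists c.
pose h s := c^-1 * b s.
have h0 s : 0 <= h s by rewrite mulr_ge0// invr_ge0 ltW.
have ch : continuous h by move=> s; apply: cvgM; [exact: cvg_cst|exact: cb].
have hb s : (h s != 0) = (b s != 0) by rewrite mulf_eq0 invr_eq0 gt_eqF.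
have int_h : (\int[mu]_s (h s)%:E = 1)%E.
  under eq_integral do rewrite EFinM.
  rewrite ge0_integralZl_EFin//.
  - by rewrite int_b -EFinM mulVf// gt_eqF.
  - by move=> s _; rewrite lee_fin.
  - by apply/measurable_EFinP; exact: continuous_borel.
  - by rewrite invr_ge0 ltW.
have h_Cc : Cc (fun s => (h s)%:C%C).
  by apply: real_Cc => //; under eq_set do rewrite hb.
exists (symbolic_calculus mu Phi Lam (fun s => (h s)%:C%C)).
  by exists (fun s => (h s)%:C%C).
rewrite /symbolic_calculus.
have /xgetPex := Phi_surjective (Cc_square_integrable cb b01 cC c^-1).
move=> /(_ 0); set k := xget _ _ => /= Phi_k.
apply: ge_ereal_sup => _ [u Ou <-]; rewrite lee_fin.
(* Testing [Lam k u - u] against itself bounds its norm. *)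
set v := Lam k u - u.
have [->|v0] := eqVneq v 0; first by rewrite rnorm0 ltW.
have nv : 0 < rnorm v by rewrite rnorm_gt0.
rewrite -(ler_pM2r nv) -expr2.
have : complex.Re (hdot (Lam k u) v) <= complex.Re (hdot u v) + e * rnorm v.
  apply: Re_symbol_le Phi_k _ => // s; rewrite hb => /bU/interior_subset/(_ u Ou).
  rewrite pi_s1 => gu; have := Re_hdot_le (adjoint (pi s) u - u) v.
  have := ler_wpM2r (ltW nv) gu; rewrite hdotBl.
  by case: (hdot _ v) (hdot u v) => ? ? [? ?] /=; lra.
have : complex.Re (hdot v v) = rnorm v ^+ 2 by rewrite -rnorm_sqr.
rewrite {1}/v hdotBl.
by case: (hdot (Lam k u) v) (hdot u v) => ? ? [? ?] /=; lra.
Qed.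

End symbolic_calculus.

(** * The equivalences *)

Lemma bounded_set_rnorm (R : realType) (H : hilbertType R) (Omega : set H) :
  bounded_set Omega -> exists B, forall u, Omega u -> rnorm u <= B.
Proof.
move=> [M [/RRe_real ME OmegaM]]; exists (complex.Re M + 1) => u Ou.
by rewrite rnorm_le OmegaM// -ME ltcR ltrDl.
Qed.

Theorem theorem1p2 (R : realType) (H : hilbertType R)
    (Sigma : ptopologicalType) (mu : {measure set (borel Sigma) -> \bar R})
    (pi : Sigma -> bounded_op H)
    (K : hilbertType R) (tens : {bilinear H -> conj_hilbert H -> K})
    (Phi : K -> Sigma -> R[i]) (Lam : K -> bounded_op H) (s1 : Sigma)
    (H_separable : separable H)
    (Sigma_hausdorff : hausdorff_space Sigma)
    (Sigma_locally_compact : locally_compact [set: Sigma])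
    (Sigma_sigma_compact : sigma_compact Sigma)
    (mu_radon : radon mu)
    (pi_square_integrable : forall u v : H,
       (\int[mu]_s (rnorm (hdot (pi s u) v) ^+ 2)%:E =
        (rnorm u ^+ 2 * rnorm v ^+ 2)%:E)%E)
    (pi_adjoint_continuous : forall u : H,
       continuous (fun s => adjoint (pi s) u))
    (K_tensor : hilbert_tensor tens)
    (Phi_isometry : l2_isometry mu Phi)
    (Phi_tens : forall u v : H,
       \forall s \ae mu, Phi (tens u v) s = hdot (pi s u) v)
    (Phi_surjective : l2_surjective mu Phi)
    (pi_s1 : forall u, adjoint (pi s1) u = u)
    (s1_support : measure_support mu s1)
    (Lam_unitary : hs_unitary Lam)
    (Lam_tens : forall u v x : H, Lam (tens u v) x = hdot x v *: u)
    (Omega : set H) (Omega_bounded : bounded_set Omega) :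
  [/\ compact (closure Omega) <->
        (exists2 w, w != 0 &
           tight_L2 mu (@Cc R Sigma) [set phi pi w u | u in Omega]),
      compact (closure Omega) <->
        (forall w, tight_L2 mu (@Cc R Sigma) [set phi pi w u | u in Omega]),
      compact (closure Omega) <->
        tight_hilbert
          [set symbolic_calculus mu Phi Lam f | f in @Cc R Sigma] Omega &
      compact (closure Omega) <->
        (forall s0,
           nneg_sup [set (rnorm (adjoint (pi s) u - adjoint (pi s0) u))%:E
                    | u in Omega] @[s --> s0] --> 0%E)].
Proof.
have [B OmegaB] := bounded_set_rnorm Omega_bounded.
have [w0 w0_neq0] : exists w : H, w != 0.
  exact: (exists_nonzero Sigma_hausdorff Sigma_locally_compact mu_radon
    Phi_isometry Phi_surjective Lam_unitary s1_support).
have compact_tight : compact (closure Omega) ->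
    forall w, tight_L2 mu (@Cc R Sigma) [set phi pi w u | u in Omega].
  exact: (tight_phi_of_relatively_compact Sigma_hausdorff Sigma_locally_compact
    Sigma_sigma_compact pi_square_integrable pi_adjoint_continuous).
have tight_compact w : w != 0 ->
    tight_L2 mu (@Cc R Sigma) [set phi pi w u | u in Omega] ->
    compact (closure Omega).
  exact: (relatively_compact_of_tight_phi mu_radon pi_square_integrable
    pi_adjoint_continuous OmegaB).
pose equicontinuous := forall (s0 : Sigma) (e : R), 0 < e ->
  \forall s \near s0, forall u, Omega u ->
    rnorm (adjoint (pi s) u - adjoint (pi s0) u) <= e.
have compact_equi : compact (closure Omega) -> equicontinuous.
  exact: (adjoint_equicontinuous Sigma_locally_compact pi_adjoint_continuous).
have equi_tight : equicontinuous -> tight_hilbert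
    [set symbolic_calculus mu Phi Lam f | f in @Cc R Sigma] Omega.
  move=> equi; exact: (tight_symbols_of_equicontinuous Sigma_hausdorff
    Sigma_locally_compact mu_radon pi_adjoint_continuous K_tensor Phi_isometry
    Phi_tens Phi_surjective Lam_unitary Lam_tens pi_s1 s1_support (equi s1)).
have symbol_compact : tight_hilbert
    [set symbolic_calculus mu Phi Lam f | f in @Cc R Sigma] Omega ->
    compact (closure Omega).
  apply: (relatively_compact_of_tight_operators K_tensor Lam_unitary Lam_tens OmegaB).
  by move=> _ [f _ <-]; exists (xget 0 [set k | Phi k = f %[ae mu]]).
split; split.
- by move=> cO; exists w0 => //; exact: compact_tight.
- by move=> [w wn0]; exact: tight_compact.
- exact: compact_tight.
- by move=> tight; exact: tight_compact w0_neq0 (tight w0).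
- by move=> /compact_equi; exact: equi_tight.
- exact: symbol_compact.
- by move=> /compact_equi equi s0; apply/nneg_sup_cvg0P; exact: equi.
- move=> equi; apply/symbol_compact/equi_tight => s0.
  exact/nneg_sup_cvg0P/equi.
Qed.
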